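(* Let $k\ge 2$ and let $X_1,\dots ,X_k\subset \mathbb{P}^n$ be integral varieties such that $X_k\nsubseteq \Delta_{n-1}$. Then for a general $(g_1,\dots ,g_{k-1})\in PGL(n+1)^{k-1}$ one has $$\dim \bigl(g_1(X_1)\star\cdots \star g_{k-1}(X_{k-1})\star X_k\bigr) =\min \{n,\dim X_1+\cdots +\dim X_k\}.$$
   Context: $\mathbb{P}^n$ is the $n$-dimensional complex projective space with a fixed system of homogeneous coordinates $x_0,\dots ,x_n$. Set $H_i:=\{x_i=0\}$ for $i=0,\dots ,n$ and $\Delta_{n-1}:=H_0\cup\cdots\cup H_n$ (the union of all coordinate hyperplanes). $PGL(n+1)=\mathrm{Aut}(\mathbb{P}^n)$ is the quotient of $GL(n+1)$ by the non-zero multiples of the identity matrix. Varieties here are closed subvarieties of $\mathbb{P}^n$. Hadamard product of points: for $P=[p_0:\dots :p_n]$ and $Q=[q_0:\dots :q_n]$ in $\mathbb{P}^n$ with $p_iq_i\ne 0$ for at least one $i$, $P\star Q:=[p_0q_0:\dots :p_nq_n]\in\mathbb{P}^n$; if $p_iq_i=0$ for all $i$, $P\star Q$ is not defined. For $k$ points the product is coordinatewise in the same way, and is well-defined when some coordinate of the product is non-zero. Hadamard product of varieties: let $X_1,\dots ,X_k\subset\mathbb{P}^n$ be irreducible subvarieties such that $P_1\star\cdots\star P_k$ is well-defined for at least one $(P_1,\dots ,P_k)\in X_1\times\cdots\times X_k$. Then it is well-defined on a non-empty Zariski open subset of $X_1\times\cdots\times X_k$, and $X_1\star\cdots\star X_k$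 is the Zariski closure in $\mathbb{P}^n$ of the set of all well-defined products $P_1\star\cdots\star P_k$ with $P_j\in X_j$. ''For a general $(g_1,\dots ,g_{k-1})$'' means for all elements of some non-empty Zariski open subset of $PGL(n+1)^{k-1}$ (depending on the $X_i$). *)

(* Defs.v *)
From HB Require Import structures.
From mathcomp Require Import all_boot all_order all_algebra.
From mathcomp Require Import generic_quotient complex mpoly.
From mathcomp Require Import boolp classical_sets reals constructive_ereal ereal.

Set Implicit Arguments.
Unset Strict Implicit.
Unset Printing Implicit Defensive.

Import Order.TTheory GRing.Theory Num.Theory.

Local Open Scope classical_set_scope.
Local Open Scope ring_scope.
Local Open Scope quotient_scope.

Section Proportional.
Variables (F : fieldType) (V : lmodType F) (P : pred V).
Implicit Types u v w : {x : V | P x}.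

Definition proportional u v : bool :=
  `[< exists2 c : F, c != 0 & val u = c *: val v >].

Lemma proportional_refl : reflexive proportional.
Proof. by move=> u; apply/asboolP; exists 1; rewrite ?oner_eq0 ?scale1r. Qed.

Lemma proportional_sym : ssrbool.symmetric proportional.
Proof.
move=> u v; apply/asbool_equiv_eq; split=> -[c c0 e];
  by exists c^-1; rewrite ?invr_eq0 // e scalerA mulVf ?scale1r.
Qed.

Lemma proportional_trans : transitive proportional.
Proof.
move=> v u w /asboolP[a a0 eu] /asboolP[b b0 ev]; apply/asboolP.
by exists (a * b); rewrite ?mulf_neq0 // eu ev scalerA.
Qed.

Canonical proportional_equiv :=
  EquivRel proportional proportional_refl proportional_sym proportional_trans.

End Proportional.

Section ProjectiveSpace.
Variables (F : fieldType) (n : nat).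

Definition nzvec := {v : 'cV[F]_n.+1 | v != 0}.

Definition proj : Type :=
  {eq_quot (@proportional F 'cV[F]_n.+1 (fun v => v != 0))}.

Definition proj_of (v : nzvec) : proj := \pi_({eq_quot _}) v.

(* Homogeneous coordinates, for a chosen representative; by [coords_proj_of]
   they are only meaningful up to a common nonzero factor. *)
Definition coords (P : proj) : 'cV[F]_n.+1 := val (repr P).

Lemma coords_neq0 (P : proj) : coords P != 0.
Proof. exact: valP (repr P). Qed.

Lemma proj_of_eq (v w : nzvec) :
  proj_of v = proj_of w <-> exists2 c : F, c != 0 & val v = c *: val w.
Proof.
by split=> [/eqmodP/asboolP | h] //; apply/eqmodP; apply/asboolP.
Qed.

Lemma coords_proj_of (v : nzvec) :
  exists2 c : F, c != 0 & coords (proj_of v) = c *: val v.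
Proof. by apply/proj_of_eq; rewrite /proj_of reprK. Qed.

Lemma proj_of_coords (P : proj) : proj_of (Sub (coords P) (coords_neq0 P)) = P.
Proof.
rewrite -[RHS]reprK; congr (\pi_({eq_quot _}) _).
by apply: val_inj; rewrite SubK.
Qed.

Definition hvanish (p : {mpoly F[n.+1]}) (P : proj) : Prop :=
  p.@[fun i => coords P i 0] = 0.

Lemma hvanish_proj_of (d : nat) (p : {mpoly F[n.+1]}) (v : nzvec) :
  p \is d.-homog -> hvanish p (proj_of v) <-> p.@[fun i => val v i 0] = 0.
Proof.
move=> /dhomogP hp; rewrite /hvanish; have [c c0 ->] := coords_proj_of v.
have -> : p.@[fun i => (c *: val v) i 0] = c ^+ d * p.@[fun i => val v i 0].
  rewrite !mevalE mulr_sumr; apply: eq_big_seq => m /hp hm.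
  under eq_bigr do rewrite mxE exprMn.
  rewrite big_split /= mulrCA; congr (_ * _).
  have -> : d = (\sum_i m i)%N by rewrite -hm; exact: mdegE.
  by elim/big_rec2: _ => // i x y _ ->; rewrite exprD.
split=> [/eqP|->]; last by rewrite mulr0.
by rewrite mulf_eq0 expf_eq0 (negPf c0) andbF => /eqP.
Qed.

Definition zclosed (X : set proj) : Prop :=
  exists2 S : set {mpoly F[n.+1]},
    (forall p, S p -> exists d, p \is d.-homog) &
    X = [set P | forall p, S p -> hvanish p P].

Definition zclosure (A : set proj) : set proj :=
  \bigcap_(Z in [set Z | zclosed Z /\ A `<=` Z]) Z.

Definition zirreducible (X : set proj) : Prop :=
  X !=set0 /\
  forall Z1 Z2, zclosed Z1 -> zclosed Z2 ->
    X `<=` Z1 `|` Z2 -> X `<=` Z1 \/ X `<=` Z2.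

Definition variety (X : set proj) : Prop := zclosed X /\ zirreducible X.

(* A chain Z 0 < ... < Z d of irreducible closed subsets of X; the values
   Z i for i > d are irrelevant. *)
Definition irr_chain (X : set proj) (d : nat) : Prop :=
  exists Z : nat -> set proj,
    (forall i, (i <= d)%N -> variety (Z i) /\ Z i `<=` X) /\
    (forall i, (i < d)%N -> Z i `<` Z i.+1).

Definition coord_hyperplane (i : 'I_n.+1) : set proj :=
  [set P | coords P i 0 = 0].

Definition coord_hyperplanes : set proj :=
  \bigcup_(i in [set: 'I_n.+1]) coord_hyperplane i.

Section Hadamard.
Variable k : nat.

Definition hadamard_coords (P : 'I_k -> proj) : 'cV[F]_n.+1 :=
  \col_i \prod_(j < k) coords (P j) i 0.

(* [None] when all the products of coordinates are zero. *)
Definition hadamard_pt (P : 'I_k -> proj) : option proj :=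
  omap proj_of (insub (hadamard_coords P)).

Definition hadamard (X : 'I_k -> set proj) : set proj :=
  zclosure [set Q | exists P : 'I_k -> proj,
                      (forall j, X j (P j)) /\ hadamard_pt P = Some Q].

Lemma hadamard_pt_proj_of (v : 'I_k -> nzvec) :
  hadamard_pt (fun j => proj_of (v j)) =
  omap proj_of (insub (\col_i \prod_(j < k) val (v j) i 0)).
Proof.
have /boolp.choice[c hc] : forall j, exists c : F,
    c != 0 /\ coords (proj_of (v j)) = c *: val (v j).
  by move=> j; have [a a0 e] := coords_proj_of (v j); exists a.
pose a := \prod_j c j.
have a0 : a != 0 by apply/prodf_neq0 => j _; exact: (hc j).1.
rewrite /hadamard_pt; set w := \col_i _.
have -> : hadamard_coords (fun j => proj_of (v j)) = a *: w.
  apply/colP => i; rewrite !mxE -big_split /=; apply: eq_bigr => j _.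
  by rewrite (hc j).2 mxE.
case: (insubP {v : 'cV[F]_n.+1 | v != 0} w) => [u nu eu|].
- case: (insubP {v : 'cV[F]_n.+1 | v != 0} (a *: w)) => [u' _ eu'|].
    by congr Some; apply/proj_of_eq; exists a; rewrite // eu' eu.
  by rewrite scaler_eq0 negb_or a0 nu.
- rewrite negbK => /eqP ->; rewrite scaler0 insubN //; by rewrite eqxx.
Qed.

End Hadamard.

Definition glmx := {A : 'M[F]_n.+1 | A \in unitmx}.

Definition pgl : Type :=
  {eq_quot (@proportional F 'M[F]_n.+1 (fun A => A \in unitmx))}.

Definition pgl_of (A : glmx) : pgl := \pi_({eq_quot _}) A.

Definition pgl_mx (g : pgl) : glmx := repr g.

Lemma pgl_of_eq (A B : glmx) :
  pgl_of A = pgl_of B <-> exists2 c : F, c != 0 & val A = c *: val B.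
Proof.
by split=> [/eqmodP/asboolP | h] //; apply/eqmodP; apply/asboolP.
Qed.

Lemma gl_act_neq0 (A : glmx) (v : nzvec) : val A *m val v != 0.
Proof.
apply: contra (valP v) => /eqP e.
by rewrite -[val v](mulKmx (valP A)) e mulmx0.
Qed.

Definition gl_act (A : glmx) (v : nzvec) : nzvec :=
  Sub (val A *m val v) (gl_act_neq0 A v).

Lemma val_gl_act (A : glmx) (v : nzvec) : val (gl_act A v) = val A *m val v.
Proof. by []. Qed.

Definition pgl_act (g : pgl) (P : proj) : proj :=
  proj_of (gl_act (pgl_mx g) (repr P)).

Lemma pgl_act_of (A : glmx) (v : nzvec) :
  pgl_act (pgl_of A) (proj_of v) = proj_of (gl_act A v).
Proof.
have [c c0 ev] := coords_proj_of v.
have /pgl_of_eq[a a0 eA] : pgl_of (pgl_mx (pgl_of A)) = pgl_of A.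
  exact: reprK.
apply/proj_of_eq; exists (a * c); first by rewrite mulf_neq0.
by rewrite !val_gl_act eA [\val (repr _)]ev -scalemxAl -scalemxAr scalerA.
Qed.

(* The matrix entries of an element of GL(n+1)^m, as a point of an affine
   space whose coordinates are indexed by an enumeration of the triples
   (factor, row, column). *)
Definition gl_entry (m : nat) (A : 'I_m -> glmx)
    (t : 'I_#|{: 'I_m * 'I_n.+1 * 'I_n.+1}|) : F :=
  let: (j, a, b) := enum_val t in val (A j) a b.

(* PGL(n+1)^m is the quotient of GL(n+1)^m by the scalars in each factor; a
   subset is Zariski open iff its preimage in GL(n+1)^m is, that is, iff this
   preimage is the non-vanishing locus of a set of polynomials in the matrix
   entries (negative powers of the determinants do not change such loci). *)
Definition pgl_open (m : nat) (U : set ('I_m -> pgl)) : Prop :=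
  exists S : set {mpoly F[#|{: 'I_m * 'I_n.+1 * 'I_n.+1}|]},
    forall A : 'I_m -> glmx,
      U (fun j => pgl_of (A j)) <-> exists2 p, S p & p.@[gl_entry A] != 0.

Definition pgl_general (m : nat) (Q : ('I_m -> pgl) -> Prop) : Prop :=
  exists U : set ('I_m -> pgl),
    [/\ pgl_open U, U !=set0 & forall g, U g -> Q g].

(* (g_1(X_1), ..., g_m(X_m), X_{m+1}) *)
Definition translate (m : nat) (g : 'I_m -> pgl) (X : 'I_m.+1 -> set proj)
    (i : 'I_m.+1) : set proj :=
  if unlift ord_max i is Some j then pgl_act (g j) @` X i else X i.

End ProjectiveSpace.

(* Krull dimension of a closed subset; the empty set has dimension -oo. *)
Definition zdim (R : realType) (n : nat) (X : set (proj R[i] n)) : \bar R :=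
  ereal_sup [set d%:R%:E | d in [set d : nat | irr_chain X d]].

(* Main.v *)
Require Import Defs.
From HB Require Import structures.
From mathcomp Require Import all_boot all_order all_algebra.
From mathcomp Require Import generic_quotient complex mpoly.
From mathcomp Require Import boolp classical_sets reals constructive_ereal ereal.

Set Implicit Arguments.
Unset Strict Implicit.
Unset Printing Implicit Defensive.

Import Order.TTheory GRing.Theory Num.Theory.

Local Open Scope classical_set_scope.
Local Open Scope ring_scope.

(* Dimensions are read off affine cones.  Call polynomials f_1, ..., f_q
   independent modulo a prime ideal I of K[x_0, ..., x_n] if P(f) in I only for
   P = 0.  A variety X has a chain of irreducible closed subsets of length d iff
   d + 1 of the coordinates are independent modulo the ideal of its cone:
   - independent coordinates on a proper closed subvariety do not generate
     K[X] algebraically, since a function vanishing on the subvariety would then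
     divide a nonzero polynomial in them (a norm);
   - if y_0, ..., y_d are independent on X, almost all points (y_0, ..., y_d)
     lift to the cone, hence for a suitable constant c no nonzero P(y_1, ..., y_d)
     lies in the ideal generated by y_0 - c y_1, and a prime ideal containing
     this one and avoiding all these P defines a smaller variety on which
     y_1, ..., y_d are independent.

   Upper bound: rescaling the factors by a torus of dimension k - 1 does not
   change the Hadamard product, so independent coordinates of the product
   together with one coordinate of each of the first k - 1 factors are
   independent on the product of the cones.

   Lower bound: let g_1, ..., g_{k-1} first be singular matrices that only select
   coordinates.  With a suitable selection, 1 + min(n, dim X_1 + ... + dim X_k)
   coordinates z(g, x) of the Hadamard product take a dense set of values.
   Specializing along a line through this g shows that (g, z(g, x)) takes a dense
   set of values when g varies as well, so it attains all (g, z) with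
   D(g, z) <> 0 for some nonzero polynomial D.  Any g with D(g, z_0) <> 0, for a
   fixed z_0, is then as good as the special one. *)

(** * Prime ideals in one variable over a domain *)

Record prime_ideal (R : comNzRingType) (I : set R) : Prop := PrimeIdeal {
  pideal0 : I 0;
  pidealD : forall x y, I x -> I y -> I (x + y);
  pidealMl : forall a x, I x -> I (a * x);
  pideal1 : ~ I 1;
  pideal_prime : forall x y, I (x * y) -> I x \/ I y }.

Section PrimeIdealTheory.
Variables (R : comNzRingType) (I : set R).
Hypothesis pI : prime_ideal I.

Lemma pidealMr a x : I x -> I (x * a).
Proof. by move=> Ix; rewrite mulrC; exact: pidealMl. Qed.

Lemma pidealN x : I x -> I (- x).
Proof. by move=> Ix; rewrite -mulN1r; exact: pidealMl. Qed.

Lemma pidealB x y : I x -> I y -> I (x - y).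
Proof. by move=> Ix Iy; apply: pidealD => //; exact: pidealN. Qed.

Lemma pidealBl x y : I (x - y) -> I y -> I x.
Proof. by move=> Ixy Iy; rewrite -(subrK y x); exact: pidealD. Qed.

Lemma pidealBr x y : I (x - y) -> I x -> I y.
Proof. by move=> Ixy Ix; rewrite -(subKr x y); exact: pidealB. Qed.

Lemma pideal_sum (T : Type) (r : seq T) (P : pred T) (F : T -> R) :
  (forall i, P i -> I (F i)) -> I (\sum_(i <- r | P i) F i).
Proof.
move=> IF; elim/big_ind: _ => //; first exact: pideal0.
exact: pidealD.
Qed.

Lemma npidealM x y : ~ I x -> ~ I y -> ~ I (x * y).
Proof. by move=> Ix Iy /(pideal_prime pI)[]. Qed.

Lemma npidealX x n : ~ I x -> ~ I (x ^+ n).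
Proof.
move=> Ix; elim: n => [|n IHn]; first by rewrite expr0; exact: pideal1.
by rewrite exprS; exact: npidealM.
Qed.

Lemma prime_ideal_preim (S : comNzRingType) (f : {rmorphism S -> R}) :
  prime_ideal [set x | I (f x)].
Proof.
split => /=; first by rewrite rmorph0; exact: pideal0.
- by move=> x y; rewrite rmorphD; exact: pidealD.
- by move=> a x; rewrite rmorphM; exact: pidealMl.
- by rewrite rmorph1; exact: pideal1.
- by move=> x y; rewrite rmorphM; exact: pideal_prime.
Qed.

End PrimeIdealTheory.

Section OneVariable.
Variables (A : idomainType) (J : set {poly A}).
Hypothesis pJ : prime_ideal J.
Implicit Types (a : A) (p q r g c f : {poly A}).
Let J0 : set A := [set a | J a%:P].

Let pJ0 : prime_ideal J0.
Proof. exact: (prime_ideal_preim pJ (polyC : {rmorphism A -> {poly A}})). Qed.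

Let JZ a p : J p -> J (a *: p).
Proof. by rewrite -mul_polyC; exact: pidealMl. Qed.

Let J_coef p : (forall i, J0 p`_i) -> J p.
Proof.
move=> Jp; rewrite -[p]coefK poly_def; apply: pideal_sum => // i _.
by rewrite -mul_polyC; apply: pidealMr => //; exact: Jp.
Qed.

(** Top terms are dropped as long as their coefficient lies in [J0], which does not change [p]
    modulo [J]. *)
Let truncate p : exists p', [/\ (size p' <= size p)%N,
  forall i, J0 (p - p')`_i & p' <> 0 -> ~ J0 (lead_coef p')].
Proof.
move: {2}(size p) (leqnn (size p)) => s; elim: s p => [|s IHs] p.
  rewrite leqn0 size_poly_eq0 => /eqP ->.
  by exists 0; split=> // i; rewrite subr0 coef0; exact: pideal0.
move=> ps; have [Jl|nJl] := pselect (J0 (lead_coef p)); last first.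
  by exists p; split=> // i; rewrite subrr coef0; exact: pideal0.
have [->|p0] := eqVneq p 0.
  by exists 0; split=> // i; rewrite subr0 coef0; exact: pideal0.
pose q := p - lead_coef p *: 'X^((size p).-1).
have sq : (size q <= (size p).-1)%N.
  apply/leq_sizeP => j; rewrite leq_eqVlt => /predU1P[<-|lt].
    by rewrite coefB coefZ coefXn eqxx mulr1 subrr.
  rewrite coefB coefZ coefXn gtn_eqF // mulr0 subr0 nth_default //.
  by rewrite -(prednK (n := size p)) // lt0n size_poly_eq0.
have [|q' [sq' Jq' nJq']] := IHs q.
  by apply: leq_trans sq _; case: (size p) ps.
exists q'; split=> //; first by rewrite (leq_trans sq') ?(leq_trans sq) ?leq_pred.
move=> i; rewrite -(subrK q p) -addrA coefD; apply: pidealD => //.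
rewrite opprB addrC subrK coefZ; exact: pidealMr.
Qed.

Let truncJ p p' : (forall i, J0 (p - p')`_i) -> J (p - p').
Proof. exact: J_coef. Qed.

(** Here [p0] plays the role of a minimal polynomial of the variable over the constants modulo [J0]:
    by minimality, truncating a shorter element of [J] leaves 0. *)
Let min_relation p : J p -> ~ (forall i, J0 p`_i) ->
  exists p0, [/\ J p0, ~ J0 (lead_coef p0) &
    forall r, J r -> (size r < size p0)%N -> forall i, J0 r`_i].
Proof.
move=> Jp nJp.
pose Q s := `[< exists q, [/\ J q, ~ J0 (lead_coef q) & size q = s] >].
have trJ r : J r -> ~ (forall i, J0 r`_i) ->
    exists q, [/\ J q, ~ J0 (lead_coef q) & (size q <= size r)%N].
  move=> Jr nJr; have [q [sq Jq nJq]] := truncate r.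
  have Jq1 : J q by apply: (pidealBr pJ (truncJ Jq)).
  exists q; split=> //; apply: nJq => q0; apply: nJr => i.
  by have := Jq i; rewrite q0 subr0.
have exQ : exists s, Q s.
  have [q [Jq nJq _]] := trJ _ Jp nJp.
  by exists (size q); apply/asboolP; exists q.
case: (ex_minnP exQ) => s /asboolP[p0 [Jp0 nJp0 <-]] smin.
exists p0; split=> // r Jr sr; apply: contrapT => nJr.
have [q [Jq nJq sq]] := trJ _ Jr nJr.
have /smin : Q (size q) by apply/asboolP; exists q.
by rewrite leqNgt (leq_ltn_trans sq sr).
Qed.

Section Norm.
Variables (p0 g : {poly A}).
Hypothesis Jp0 : J p0.
Hypothesis nJp0 : ~ J0 (lead_coef p0).
Hypothesis minp0 :
  forall r, J r -> (size r < size p0)%N -> forall i, J0 r`_i.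
Hypothesis nJg : ~ J g.

Let normed c := ~ J c /\ exists q, J (q * g - c).

Let min_normed : exists c, [/\ normed c, ~ J0 (lead_coef c) &
  forall r, (size r < size c)%N -> (exists q, J (q * g - r)) -> J r].
Proof.
pose Q s := `[< exists q, [/\ normed q, ~ J0 (lead_coef q) & size q = s] >].
have trN r : normed r ->
    exists q, [/\ normed q, ~ J0 (lead_coef q) & (size q <= size r)%N].
  move=> [nJr [u Ju]]; have [q [sq Jq nJq]] := truncate r.
  have nJq1 : ~ J q.
    by move=> Jq1; apply: nJr; apply: (pidealBl pJ (truncJ Jq)).
  exists q; split=> //; last first.
    by apply: nJq => q0; apply: nJq1; rewrite q0; exact: pideal0.
  split=> //; exists u; rewrite -(subrK r (u * g)) -addrA.
  by apply: pidealD => //; apply: truncJ.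
have exQ : exists s, Q s.
  have [|q [nq nJq _]] := trN g.
    by split=> //; exists 1; rewrite mul1r subrr; exact: pideal0.
  by exists (size q); apply/asboolP; exists q.
case: (ex_minnP exQ) => s /asboolP[c [nc nJc <-]] smin.
exists c; split=> // r sr [u Ju]; apply: contrapT => nJr.
have [|q [nq nJq sq]] := trN r; first by split=> //; exists u.
have /smin : Q (size q) by apply/asboolP; exists q.
by rewrite leqNgt (leq_ltn_trans sq sr).
Qed.

(* A polynomial [c] of least degree outside [J] and in the ideal generated by
   [J] and [g] is constant: by minimality of [c], then of [p0], it would otherwise
   divide [p0] up to elements of [J], with a quotient in [J] of degree less than
   that of [p0]. *)
Lemma norm_min : exists a, ~ J0 a /\ exists q, J (q * g - a%:P).
Proof.
have [c [[nJc [u Ju]] nJlc cmin]] := min_normed.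
have c0 : c != 0.
  by apply: contra_notN nJc => /eqP->; exact: pideal0.
have p00 : p0 != 0.
  by apply: contra_notN nJp0 => /eqP->; rewrite lead_coef0; exact: pideal0.
have [sc|sc] := leqP (size c) 1.
  exists (lead_coef c); split=> //; exists u.
  by have /size1_polyC -> := sc; rewrite lead_coefC -(size1_polyC sc).
exfalso.
have multc q r k : (k *: c = q * p0 + r) -> exists q', J (q' * g - r).
  move=> e; exists (k *: u).
  have -> : k *: u * g - r = k *: (u * g - c) + q * p0.
    by rewrite scalerBr e -scalerAl opprD addrA addrAC subrK.
  by apply: pidealD => //; [exact: JZ | exact: pidealMl].
(* If [p0] is shorter than [c], the pseudo-remainder of [c] by [p0] is a multiple of [g] modulo [J]
   shorter than [c], hence in [J]. So a power of [lead_coef p0] times [c] lies in [J], which is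
   impossible. *)
have [pc|cp] := ltnP (size p0) (size c).
  have e := Pdiv.Idomain.divp_eq c p0.
  have := ltn_modp c p0; rewrite p00 => sm.
  have Jm := cmin _ (ltn_trans sm pc) (multc _ _ _ e).
  have : J (lead_coef p0 ^+ scalp c p0 *: c).
    by rewrite e; apply: pidealD => //; exact: pidealMl.
  rewrite -mul_polyC; apply: npidealM => //.
  exact: (npidealX pJ0 nJp0).
have e := Pdiv.Idomain.divp_eq p0 c; set k := _ ^+ _ in e.
have nJk : ~ J0 k by exact: (npidealX pJ0 nJlc).
have sm : (size (p0 %% c)%R < size c)%N by rewrite ltn_modp.
have Jm : J (p0 %% c).
  apply: cmin => //; exists (- (p0 %/ c) * u).
  have -> : - (p0 %/ c) * u * g - p0 %% c =
      - (p0 %/ c) * (u * g - c) - k *: p0.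
    by rewrite e mulrBr mulrA opprD !mulNr opprK addrA addrK.
  by apply: pidealB => //; [exact: pidealMl | exact: JZ].
have Jcm := minp0 Jm (leq_trans sm cp).
have k0 : k != 0 by rewrite expf_neq0 // lead_coef_eq0.
have Jq : J (p0 %/ c).
  have : J (p0 %/ c * c).
    by rewrite -(addrK (p0 %% c) (_ * c)) -e; apply: pidealB => //; exact: JZ.
  by case/(pideal_prime pJ).
have sqc : size (p0 %/ c * c) = size p0.
  rewrite -(addrK (p0 %% c) (_ * c)) -e size_polyDl size_scale //.
  by rewrite size_polyN (leq_trans sm).
have q0 : p0 %/ c != 0.
  by apply: contraNneq p00 => q0; rewrite -size_poly_eq0 -sqc q0 mul0r size_poly0.
have sq : (size (p0 %/ c)%R < size p0)%N.
  rewrite -sqc size_mul // -(prednK (n := size c)) ?(ltn_trans _ sc) //.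
  by rewrite addnS /= -{1}[size _]addn0 ltn_add2l -subn1 subn_gt0.
have Jlq : J0 (lead_coef (p0 %/ c)) by exact: (minp0 Jq sq).
(* Up to an element of [J0], this coefficient is [k * lead_coef p0], and neither factor lies in
   [J0]. *)
have : J0 (lead_coef (p0 %/ c * c)) by rewrite lead_coefM; exact: pidealMr.
rewrite lead_coefE sqc -(addrK (p0 %% c) (_ * c)) -e coefB coefZ => Jl.
have : J0 (k * lead_coef p0) by exact: (pidealBl pJ0 Jl).
exact: npidealM.
Qed.

End Norm.

(** The relation [p] makes the variable algebraic over the constants modulo [J], so [g] divides a
    nonzero constant there, as an algebraic element divides its norm. *)
Lemma norm_poly p g : J p -> ~ (forall i, J0 p`_i) -> ~ J g ->
  exists a, ~ J a%:P /\ exists q, J (q * g - a%:P).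
Proof.
move=> Jp nJp nJg; have [p0 [Jp0 nJp0 minp0]] := min_relation Jp nJp.
exact: (@norm_min p0).
Qed.

(** One-variable step of the Nullstellensatz: a general specialization [phi] of the constants
    extends to a zero of [J] at which [g] does not vanish. *)
Lemma extend_poly (K : closedFieldType) g : ~ J g ->
  exists h, ~ J h%:P /\ forall phi : {rmorphism A -> K},
    (forall a, J a%:P -> phi a = 0) -> phi h != 0 ->
    exists x, (forall f, J f -> (map_poly phi f).[x] = 0) /\
              (map_poly phi g).[x] != 0.
Proof.
move=> nJg.
have map0 (phi : {rmorphism A -> K}) : (forall a, J a%:P -> phi a = 0) ->
    forall f, (forall i, J0 f`_i) -> map_poly phi f = 0.
  move=> phiJ f Jf; apply/polyP => i.
  by rewrite coef_map coef0 /= phiJ //; exact: Jf.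
(* Transcendental case: [phi] kills all of [J], so [x] only has to avoid the roots of the image of
   [g]; [h] is a coefficient that keeps this image nonzero. *)
have [triv|] := pselect (forall p, J p -> forall i, J0 p`_i).
  have [g' [_ Jg' nJg']] := truncate g.
  exists (lead_coef g'); split.
    apply: nJg' => g'0; apply: nJg; apply: J_coef => i.
    by have := Jg' i; rewrite g'0 subr0.
  move=> phi phiJ phih.
  have : map_poly phi g != 0.
    rewrite -(subrK g' g) rmorphD /= (map0 phi phiJ) // add0r.
    apply: contraNneq phih => e.
    by rewrite lead_coefE -coef_map e coef0.
  move=> /closed_nonrootP[x]; rewrite rootE => gx; exists x; split=> // f Jf.
  by rewrite map0 ?horner0 //; exact: triv.
move=> /existsNP[p /not_implyP[Jp nJp]].
have [p0 [Jp0 nJp0 minp0]] := min_relation Jp nJp.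
have [a [nJa [q Jq]]] := norm_min Jp0 nJp0 minp0 nJg.
(* Algebraic case: the first factor keeps the image of [p0] nonconstant, so that it has a root [x];
   the second is a multiple of [g] modulo [J] and forces [g] to be nonzero at [x]. *)
exists (lead_coef p0 * a); split; first exact: (npidealM pJ0).
move=> phi phiJ; rewrite rmorphM mulf_eq0 negb_or => /andP[phil phia].
have szp : size (map_poly phi p0) = size p0 by rewrite size_map_poly_id0.
have : size (map_poly phi p0) != 1%N.
  apply/eqP; rewrite szp => s1; apply: nJp0.
  by have := Jp0; rewrite (size1_polyC (eq_leq s1)) lead_coefC.
move=> /closed_rootP[x]; rewrite rootE => /eqP p0x.
(* Pseudo-division by [p0] leaves a remainder in [J] shorter than [p0], which [phi] kills. *)
have zero f : J f -> (map_poly phi f).[x] = 0.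
  move=> Jf; have := Pdiv.Idomain.divp_eq f p0; set k := _ ^+ _ => e.
  have p00 : p0 != 0.
    by apply: contra_neq phil => ->; rewrite lead_coef0 rmorph0.
  have Jm : J (f %% p0).
    rewrite -(addKr (f %/ p0 * p0) (f %% p0)) -e addrC.
    by apply: pidealB => //; [exact: JZ | exact: pidealMl].
  have := congr1 (fun h => (map_poly phi h).[x]) e.
  rewrite /= rmorphD rmorphM /= hornerD hornerM p0x mulr0 add0r.
  rewrite (map0 phi phiJ (f %% p0)); last by apply: minp0; rewrite ?ltn_modp.
  rewrite horner0 map_polyZ hornerZ => /eqP; rewrite mulf_eq0 => /orP[|/eqP //].
  by rewrite rmorphXn expf_eq0 (negbTE phil) andbF.
exists x; split=> //; apply: contraNneq phia => gx.
have := zero _ Jq; rewrite rmorphB rmorphM /= hornerD hornerM gx mulr0 add0r.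
by rewrite hornerN map_polyC hornerC => /eqP; rewrite oppr_eq0.
Qed.

End OneVariable.

(** * Several variables *)

Lemma mpoly_rmorph_eq n (R : nzRingType) (S : nzRingType)
    (f g : {rmorphism {mpoly R[n]} -> S}) :
  (forall c, f c%:MP = g c%:MP) -> (forall i, f 'X_i = g 'X_i) -> f =1 g.
Proof.
move=> eC eX p; rewrite [p]mpolyE !rmorph_sum; apply: eq_bigr => m _.
rewrite -mul_mpolyC !rmorphM eC; congr (_ * _); rewrite mpolyXE_id !rmorph_prod.
by apply: eq_bigr => i _; rewrite !rmorphXn /= eX.
Qed.

Definition snoc (T : Type) n (f : 'I_n -> T) (x : T) (i : 'I_n.+1) : T :=
  if unlift ord_max i is Some j then f j else x.

Lemma snoc_lift T n (f : 'I_n -> T) x j : snoc f x (lift ord_max j) = f j.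
Proof. by rewrite /snoc liftK. Qed.

Lemma snoc_max T n (f : 'I_n -> T) x : snoc f x ord_max = x.
Proof. by rewrite /snoc unlift_none. Qed.

Lemma snoc_ind n (P : 'I_n.+1 -> Prop) :
  (forall j, P (lift ord_max j)) -> P ord_max -> forall i, P i.
Proof. by move=> Pl Pm i; case: (unliftP ord_max i) => [j|] ->. Qed.

Section LastVariable.
Variables (n : nat) (R : comNzRingType).

Lemma muni_XU (i : 'I_n.+1) : muni ('X_i : {mpoly R[n.+1]}) =
  'X_[[multinom (U_(i)%MM (lift ord_max j)) | j < n]] *: 'X^(U_(i)%MM ord_max).
Proof.
rewrite muniE msuppX big_seq1 mcoeffX eqxx scale1r.
congr ('X_[_] *: _); apply/mnmP => j; rewrite !mnmE; congr (_ == _ : nat).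
by apply: val_inj; rewrite /= /bump leqNgt ltn_ord.
Qed.

Lemma muni_X_lift (j : 'I_n) :
  muni ('X_(lift ord_max j) : {mpoly R[n.+1]}) = ('X_j)%:P.
Proof.
rewrite muni_XU mnm1E eq_sym (negbTE (neq_lift _ _)).
rewrite expr0 alg_polyC; congr ('X_[_])%:P; apply/mnmP => l.
by rewrite !mnmE (inj_eq (@lift_inj _ _)).
Qed.

Lemma muni_X_max : muni ('X_ord_max : {mpoly R[n.+1]}) = 'X.
Proof.
rewrite muni_XU mnm1E eqxx expr1 -[RHS]scale1r; congr (_ *: _).
rewrite -mpolyX0; congr 'X_[_]; apply/mnmP => l.
by rewrite !mnmE (negbTE (neq_lift _ _)).
Qed.

(** A left inverse of [muni]. Pulling a prime ideal back along it reduces statements on [n.+1]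
    variables to one variable over a domain. *)
Definition mpoly_of_poly : {poly {mpoly R[n]}} -> {mpoly R[n.+1]} :=
  horner_eval 'X_ord_max \o map_poly (@mwiden n R).

HB.instance Definition _ := GRing.RMorphism.on mpoly_of_poly.

Lemma mpoly_of_polyC a : mpoly_of_poly a%:P = mwiden a.
Proof. by rewrite /mpoly_of_poly /= map_polyC /horner_eval hornerC. Qed.

Lemma mwiden_X (j : 'I_n) :
  mwiden ('X_j : {mpoly R[n]}) = 'X_(lift ord_max j).
Proof.
rewrite mwidenX mnmwiden1; congr 'X_[U_(_)].
by apply: val_inj; rewrite /= /bump leqNgt ltn_ord.
Qed.

Lemma mpoly_of_muni (p : {mpoly R[n.+1]}) : mpoly_of_poly (muni p) = p.
Proof.
apply: (@mpoly_rmorph_eq _ _ _ (mpoly_of_poly \o @muni n R) idfun) => [c|] /=.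
  by rewrite muniC mpoly_of_polyC mwidenC.
apply: snoc_ind => [j|].
  by rewrite muni_X_lift mpoly_of_polyC mwiden_X.
by rewrite muni_X_max /mpoly_of_poly /= map_polyX /horner_eval hornerX.
Qed.

Lemma muni_mwiden (p : {mpoly R[n]}) : muni (mwiden p) = p%:P.
Proof.
apply: (@mpoly_rmorph_eq _ _ _ (@muni n R \o @mwiden n R) polyC) => [c|j] /=.
  by rewrite mwidenC muniC.
by rewrite mwiden_X muni_X_lift.
Qed.

Lemma mmap_snoc (S : comNzRingType) (phi : {rmorphism R -> S}) v x
    (p : {mpoly R[n.+1]}) :
  mmap phi (snoc v x) p = (map_poly (mmap phi v) (muni p)).[x].
Proof.
apply: (@mpoly_rmorph_eq _ _ _ (mmap phi (snoc v x))
   (horner_eval x \o map_poly (mmap phi v) \o @muni n R)) => [c|] /=.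
  by rewrite mmapC muniC map_polyC /= mmapC /horner_eval hornerC.
apply: snoc_ind => [j|]; rewrite mmapX mmap1U /horner_eval.
  by rewrite snoc_lift muni_X_lift map_polyC /= mmapX mmap1U hornerC.
by rewrite snoc_max muni_X_max map_polyX hornerX.
Qed.

End LastVariable.

Lemma mpoly0E (R : comNzRingType) (p : {mpoly R[0]}) : exists c, p = c%:MP.
Proof.
exists p.@[fun=> 0]; apply: (@mpoly_rmorph_eq _ _ _ idfun
  (@mpolyC 0 R \o meval (fun=> 0))) => [c|[]//] /=.
by rewrite mevalC.
Qed.

(** Norms are taken one variable at a time: eliminating the last variable turns [g] into some [a] in
    the other variables, and the induction hypothesis for the contracted ideal turns [a] into a
    constant. *)
Lemma norm_mpoly n (A : idomainType) (J : set {mpoly A[n]}) g :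
  prime_ideal J ->
  (forall i, exists p : {poly A}, ~ (forall k, J (p`_k)%:MP) /\
                            J (map_poly (@mpolyC n A) p).['X_i]) ->
  ~ J g -> exists a : A, ~ J a%:MP /\ exists q, J (q * g - a%:MP).
Proof.
elim: n => [|n IHn] in J g *; move=> pJ algX nJg.
  have [c e] := mpoly0E g; exists c; rewrite -e; split=> //.
  by exists 1; rewrite mul1r subrr; exact: (pideal0 pJ).
pose mop := @mpoly_of_poly n A.
have [a [nJa [q Jq]]] : exists a, ~ J (mop a%:P) /\
    exists q, J (mop (q * muni g - a%:P)).
  have [p [nJp Jp]] := algX ord_max.
  apply: (@norm_poly _ _ (prime_ideal_preim pJ mop)
    (map_poly (@mpolyC n A) p)); rewrite /= ?mpoly_of_muni //.
  - rewrite /mop /mpoly_of_poly /= -map_poly_comp /horner_eval.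
    by under eq_map_poly do rewrite /= mwidenC.
  - move=> Jp'; apply: nJp => k; have := Jp' k.
    by rewrite coef_map /= /mop mpoly_of_polyC mwidenC.
have [|||b [nJb [r Jr]]] := IHn [set x | J (mwiden x)] a.
- exact: prime_ideal_preim.
- move=> i; have [p [nJp Jp]] := algX (lift ord_max i).
  exists p => /=; split.
    by move=> Jp'; apply: nJp => k; have := Jp' k; rewrite mwidenC.
  rewrite -horner_map /= mwiden_X -map_poly_comp.
  by under eq_map_poly do rewrite /= mwidenC.
- by rewrite /= -mpoly_of_polyC.
exists b; move: nJb Jr => /=; rewrite rmorphB rmorphM /= mwidenC => nJb Jr.
split=> //; exists (mwiden r * mop q).
have -> : mwiden r * mop q * g - b%:MP =
    mwiden r * (mop (q * muni g - a%:P)) + (mwiden r * mwiden a - b%:MP).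
  rewrite /mop rmorphB rmorphM /= mpoly_of_muni mpoly_of_polyC.
  by rewrite mulrBr mulrA addrA subrK.
by apply: pidealD => //; exact: pidealMl.
Qed.

(** The coordinates of [v] are found one at a time: [h] is the condition for the last one to exist,
    and the induction hypothesis finds the others with [h] nonzero. *)
Lemma extend_mpoly n (A : idomainType) (K : closedFieldType)
    (J : set {mpoly A[n]}) g :
  prime_ideal J -> ~ J g ->
  exists h : A, ~ J h%:MP /\ forall phi : {rmorphism A -> K},
    (forall a, J a%:MP -> phi a = 0) -> phi h != 0 ->
    exists v, (forall f, J f -> mmap phi v f = 0) /\ mmap phi v g != 0.
Proof.
elim: n => [|n IHn] in J g *; move=> pJ nJg.
  have [c e] := mpoly0E g; exists c; rewrite -e; split=> // phi phiJ phic.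
  exists (fun=> 0); rewrite e mmapC; split=> // f.
  by have [d ->] := mpoly0E f; rewrite mmapC; exact: phiJ.
pose mop := @mpoly_of_poly n A.
have [|h [nJh exth]] :=
    @extend_poly _ _ (prime_ideal_preim pJ mop) K (muni g).
  by rewrite /= mpoly_of_muni.
have [||b [nJb extb]] := IHn [set x | J (mwiden x)] h.
- exact: prime_ideal_preim.
- by rewrite /= -mpoly_of_polyC.
exists b; split; first by move: nJb => /=; rewrite mwidenC.
move=> phi phiJ phib.
have [|v [vJ vh]] := extb phi _ phib.
  by move=> a /=; rewrite mwidenC; exact: phiJ.
have [|x [xJ xg]] := exth (mmap phi v) _ vh.
  by move=> a /=; rewrite mpoly_of_polyC; exact: vJ.
exists (snoc v x); split=> [f Jf|]; rewrite mmap_snoc //.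
by apply: xJ; rewrite /= mpoly_of_muni.
Qed.

(** * Points and independent polynomials modulo a prime ideal *)

(** Krull's argument: an ideal maximal among those that contain [I] and are disjoint from the
    multiplicative set [M] is prime. *)
Lemma prime_ideal_avoiding (R : comNzRingType) (I M : set R) :
  I 0 -> (forall x y, I x -> I y -> I (x + y)) ->
  (forall a x, I x -> I (a * x)) ->
  M 1 -> (forall x y, M x -> M y -> M (x * y)) ->
  (forall x, I x -> ~ M x) ->
  exists J, [/\ prime_ideal J, I `<=` J & forall x, J x -> ~ M x].
Proof.
move=> I0 ID IM M1 MM IMdisj.
pose good (A : set R) := [/\ I `<=` A, forall x y, A x -> A y -> A (x + y),
  forall a x, A x -> A (a * x) & forall x, A x -> ~ M x].
have [F Fgood Ftot|A [[A0|[IA AD AM Adisj]] Amax]] :=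
    @Zorn_bigcup R [set A | A = set0 \/ good A].
- have [Fe|/existsNP[A /not_implyP[FA /eqP/set0P A0]]] :=
      pselect (forall A, F A -> A = set0).
    by left; rewrite -subset0 => x [A /Fe ->].
  right; have goodF B x : F B -> B x -> good B.
    by move=> FB Bx; case: (Fgood _ FB) => // B0; move: Bx; rewrite B0.
  have [x0 Ax0] := A0; have [IA _ _ _] := goodF _ _ FA Ax0.
  split.
  + by move=> x Ix; exists A => //; exact: IA.
  + move=> x y [B FB Bx] [C FC Cy].
    case: (Ftot _ _ FB FC) => [BC|CB].
      by exists C => //; have [_ CD _ _] := goodF _ _ FC Cy; apply: CD => //; exact: BC.
    by exists B => //; have [_ BD _ _] := goodF _ _ FB Bx; apply: BD => //; exact: CB.
  + move=> a x [B FB Bx]; exists B => //.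
    by have [_ _ BM _] := goodF _ _ FB Bx; exact: BM.
  + by move=> x [B FB Bx]; have [_ _ _ Bd] := goodF _ _ FB Bx; exact: Bd.
- exfalso; apply: (Amax I); last by right; split.
  by rewrite A0; split=> // /(_ 0 I0).
exists A; split=> //; split; [exact: IA | exact: AD | exact: AM | |].
  by move=> A1; exact: (Adisj 1).
move=> x y Axy; apply: contrapT => /not_orP[Ax Ay].
(* By maximality the ideal generated by [A] and [z] meets [M]. For [x] and [y], the product of the
   two elements found lies in both [A] and [M]. *)
have meet z : ~ A z -> exists a r, A a /\ M (a + r * z).
  move=> Az; apply: contrapT => nmeet.
  apply: (Amax [set w | exists a r, A a /\ w = a + r * z]).
    split=> [w Aw|sub]; first by exists w, 0; rewrite mul0r addr0.
    apply: Az; apply: sub; exists 0, 1; rewrite mul1r add0r; split=> //.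
    exact: IA.
  right; split.
  - by move=> w /IA Aw; exists w, 0; rewrite mul0r addr0.
  - move=> _ _ [a [r [Aa ->]]] [b [s [Ab ->]]]; exists (a + b), (r + s).
    by split; [exact: AD | rewrite mulrDl addrACA].
  - move=> c _ [a [r [Aa ->]]]; exists (c * a), (c * r).
    by split; [exact: AM | rewrite mulrDr mulrA].
  - by move=> _ [a [r [Aa ->]]] Mw; apply: nmeet; exists a, r.
have [a [r [Aa Ma]]] := meet _ Ax; have [b [s [Ab Mb]]] := meet _ Ay.
apply: (Adisj _ _ (MM _ _ Ma Mb)).
rewrite mulrDl; apply: (AD); first by rewrite mulrC; exact: AM.
rewrite mulrDr; apply: (AD); first exact: AM.
by rewrite mulrACA; exact: AM.
Qed.

Section AffineSpace.
Variable K : closedFieldType.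

Definition psub N q (f : 'I_q -> {mpoly K[N]}) : {mpoly K[q]} -> {mpoly K[N]} :=
  mmap (@mpolyC N K) f.

HB.instance Definition _ N q (f : 'I_q -> {mpoly K[N]}) :=
  GRing.RMorphism.on (psub f).

Lemma psubX N q (f : 'I_q -> {mpoly K[N]}) i : psub f 'X_i = f i.
Proof. by rewrite /psub mmapX mmap1U. Qed.

Lemma psubC N q (f : 'I_q -> {mpoly K[N]}) c : psub f c%:MP = c%:MP.
Proof. by rewrite /psub mmapC. Qed.

Lemma meval_psub N q (f : 'I_q -> {mpoly K[N]}) p v :
  (psub f p).@[v] = p.@[fun i => (f i).@[v]].
Proof.
apply: (@mpoly_rmorph_eq _ _ _ (meval v \o psub f)
  (meval (fun i => (f i).@[v]))) => [c|i] /=.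
  by rewrite psubC !mevalC.
by rewrite psubX mevalXU.
Qed.

Lemma mpoly_null_prime N : prime_ideal [set p : {mpoly K[N]} | p = 0].
Proof.
split=> //= [x y -> ->|a x ->|/eqP|x y /eqP]; rewrite ?addr0 ?mulr0 ?oner_eq0 //.
by rewrite mulf_eq0 => /orP[] /eqP; [left|right].
Qed.

(** A prime ideal contains no nonzero constant, so the identity of [K] is an admissible
    specialization in [extend_mpoly]. *)
Lemma nullstellensatz N (I : set {mpoly K[N]}) g : prime_ideal I -> ~ I g ->
  exists v, (forall f, I f -> f.@[v] = 0) /\ g.@[v] != 0.
Proof.
move=> pI nIg; have [h [nIh ext]] := extend_mpoly K pI nIg.
have const c : I c%:MP -> c = 0.
  move=> Ic; apply/eqP/negPn/negP => c0; apply: (pideal1 pI).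
  rewrite -mpolyC1 -(mulVf c0) mpolyCM; exact: pidealMl.
apply: (ext idfun const).
by apply: contra_notN nIh => /eqP /= ->; rewrite mpolyC0; exact: pideal0.
Qed.

Lemma mpoly_nonroot N (p : {mpoly K[N]}) : p != 0 -> exists v, p.@[v] != 0.
Proof.
by move=> /eqP p0; have [v [_]] := nullstellensatz (@mpoly_null_prime N) p0; exists v.
Qed.

Definition indep N q (I : set {mpoly K[N]}) (f : 'I_q -> {mpoly K[N]}) :=
  forall p, I (psub f p) -> p = 0.

Section Graph.
Variables (N q : nat) (f : 'I_q -> {mpoly K[N]}).

Let A := {mpoly K[q]}.

(** The parameters, that is the variables of [A], are sent to the [f i]. The preimage of an ideal is
    the ideal of the graph of [f] over its zeros, with the parameters as constants. *)
Definition over_params : {mpoly A[N]} -> {mpoly K[N]} :=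
  mmap (psub f) (fun i => 'X_i).

HB.instance Definition _ := GRing.RMorphism.on over_params.

Lemma over_paramsC (a : A) : over_params a%:MP = psub f a.
Proof. by rewrite /over_params mmapC. Qed.

Lemma over_paramsX i : over_params 'X_i = 'X_i.
Proof. by rewrite /over_params mmapX mmap1U. Qed.

Definition lift_params : {mpoly K[N]} -> {mpoly A[N]} :=
  mmap (@mpolyC N A \o @mpolyC q K) (fun i => 'X_i).

HB.instance Definition _ := GRing.RMorphism.on lift_params.

Lemma lift_paramsC c : lift_params c%:MP = (c%:MP : A)%:MP.
Proof. by rewrite /lift_params mmapC. Qed.

Lemma lift_paramsX i : lift_params 'X_i = 'X_i.
Proof. by rewrite /lift_params mmapX mmap1U. Qed.

Lemma lift_paramsK p : over_params (lift_params p) = p.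
Proof.
apply: (@mpoly_rmorph_eq _ _ _ (over_params \o lift_params) idfun) => [c|i] /=.
  by rewrite lift_paramsC over_paramsC psubC.
by rewrite lift_paramsX over_paramsX.
Qed.

Lemma mmap_lift_params eta v p : mmap (meval eta) v (lift_params p) = p.@[v].
Proof.
apply: (@mpoly_rmorph_eq _ _ _ (mmap (meval eta) v \o lift_params) (meval v))
  => [c|i] /=.
  by rewrite lift_paramsC mmapC /= !mevalC.
by rewrite lift_paramsX mmapX mmap1U mevalXU.
Qed.

End Graph.

(** A dominant map hits almost all points. Independence says that the graph ideal contains no
    nonzero constant, so evaluation of the parameters at any [eta] is an admissible specialization
    in [extend_mpoly]. *)
Lemma lift_points N q (I : set {mpoly K[N]}) (f : 'I_q -> {mpoly K[N]}) :
  prime_ideal I -> indep I f ->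
  exists D : {mpoly K[q]}, D != 0 /\ forall eta, D.@[eta] != 0 ->
    exists v, (forall p, I p -> p.@[v] = 0) /\ forall i, (f i).@[v] = eta i.
Proof.
move=> pI If; pose J := [set p | I (over_params f p)].
have pJ : prime_ideal J by exact: prime_ideal_preim.
have [D [nJD ext]] := extend_mpoly K pJ (pideal1 pJ).
exists D; split.
  by apply: contra_notN nJD => /eqP->; rewrite mpolyC0; exact: pideal0.
move=> eta Deta; have [|v [vJ _]] := ext (meval eta) _ Deta.
  by move=> a; rewrite /J /= over_paramsC => /If->; rewrite meval0.
exists v; split=> [p Ip|i].
  by rewrite -(mmap_lift_params eta) vJ // /J /= lift_paramsK.
have := vJ (('X_i : {mpoly K[q]})%:MP - lift_params q (f i)).
rewrite /J /= !rmorphB /= over_paramsC lift_paramsK psubX subrr.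
rewrite mmapC mmap_lift_params /= mevalXU => /(_ (pideal0 pI))/eqP.
by rewrite subr_eq0 => /eqP.
Qed.

(** Otherwise all the coordinates are algebraic over [f] modulo [I], and [g] divides there a nonzero
    polynomial in [f]. As [g] lies in [J], so does this polynomial, against independence modulo
    [J]. *)
Lemma indep_extend N q (I J : set {mpoly K[N]}) (f : 'I_q -> {mpoly K[N]}) g :
  prime_ideal I -> prime_ideal J -> I `<=` J -> J g -> ~ I g -> indep J f ->
  exists i, indep I (snoc f 'X_i).
Proof.
move=> pI pJ IJ Jg nIg Jf; apply: contrapT => nind.
pose L := [set p | I (over_params f p)].
have [|i||a [nLa [r]]] := @norm_mpoly _ _ L (lift_params q g).
- exact: prime_ideal_preim.
- have /existsNP[P /not_implyP[IP P0]] : ~ indep I (snoc f 'X_i).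
    by move=> ind; apply: nind; exists i.
  exists (muni P); split=> [triv|].
    apply: P0; rewrite -(mpoly_of_muni P); suff -> : muni P = 0 by rewrite rmorph0.
    apply/polyP => k; rewrite coef0; apply: Jf; apply: IJ.
    by have := triv k; rewrite /L /= over_paramsC.
  rewrite /L /= -horner_map /= over_paramsX -map_poly_comp.
  under eq_map_poly do rewrite /= over_paramsC.
  by rewrite -mmap_snoc.
- by rewrite /L /= lift_paramsK.
rewrite /L /= rmorphB rmorphM /= lift_paramsK over_paramsC => Ir.
apply: nLa; rewrite /L /= over_paramsC.
suff -> : a = 0 by rewrite rmorph0; exact: pideal0.
by apply: Jf; apply: (pidealBr pJ (IJ _ Ir)); exact: pidealMl.
Qed.

(** The slice is the hypersurface where the last polynomial equals [c] times [W] of the others. The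
    choice [W = 1] suffices for affine purposes; a variable [W] makes the equation a linear form
    when the [f i] are coordinates. *)
Lemma indep_slice N q (I : set {mpoly K[N]}) (f : 'I_q.+1 -> {mpoly K[N]})
    (W : {mpoly K[q]}) :
  prime_ideal I -> indep I f -> W != 0 ->
  let f' := fun j => f (lift ord_max j) in
  exists (c : K) (J : set {mpoly K[N]}), [/\ prime_ideal J, I `<=` J,
    indep J f', J (f ord_max - c *: psub f' W) &
    ~ I (f ord_max - c *: psub f' W)].
Proof.
move=> pI If W0 f'; have [D [D0 lift]] := lift_points pI If.
have mD0 : muni D != 0.
  by apply: contraNneq D0 => mD; rewrite -(mpoly_of_muni D) mD rmorph0.
(* The exceptional locus of [D] must not contain the whole slice: take a point off this locus with
   [W] nonzero, and the slice through it. *)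
have [c Dc0] : exists c : K, (muni D).[c *: W] != 0.
  have [i Di] : exists i, (muni D)`_i != 0.
    by exists (size (muni D)).-1; rewrite -lead_coefE lead_coef_eq0.
  have [v] := mpoly_nonroot (mulf_neq0 Di W0).
  rewrite mevalM mulf_eq0 negb_or => /andP[Div Wv].
  have : map_poly (meval v) (muni D) != 0.
    by apply: contraNneq Div => e; rewrite -coef_map e coef0.
  move=> /closed_nonrootP[x]; rewrite rootE => Dx.
  exists (x / W.@[v]); apply: contraNneq Dx => e.
  have := congr1 (meval v) e; rewrite meval0 -horner_map /= mevalZ divfK //.
  by move=> ->.
exists c; set u := _ - _.
have psubf' p : psub f (mwiden p) = psub f' p.
  apply: (@mpoly_rmorph_eq _ _ _ (psub f \o @mwiden q K) (psub f')) => [d|j] /=.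
    by rewrite mwidenC !psubC.
  by rewrite mwiden_X !psubX.
have nIu : ~ I u.
  have -> : u = psub f ('X_ord_max - c *: mwiden W).
    by rewrite /u rmorphB /= psubX -!mul_mpolyC rmorphM /= psubC psubf'.
  move=> /If /(congr1 (@muni q K)).
  rewrite muniB muniZ muni_X_max muni_mwiden muni0 => /polyP/(_ 1%N)/eqP.
  by rewrite -mul_polyC -polyCM coefB coefX coefC subr0 coef0 oner_eq0.
have [||||||J [pJ IJ JM]] := @prime_ideal_avoiding _
    [set x | exists i b, I i /\ x = i + b * u]
    [set x | exists P, P != 0 /\ x = psub f' P].
- by exists 0, 0; rewrite mul0r addr0; split=> //; exact: pideal0.
- move=> _ _ [i [a [Ii ->]]] [j [b [Ij ->]]]; exists (i + j), (a + b).
  by split; [exact: pidealD | rewrite mulrDl addrACA].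
- move=> a _ [i [b [Ii ->]]]; exists (a * i), (a * b).
  by split; [exact: pidealMl | rewrite mulrDr mulrA].
- by exists 1; rewrite oner_eq0 rmorph1.
- move=> _ _ [P [P0 ->]] [Q [Q0 ->]]; exists (P * Q).
  by rewrite mulf_neq0 // rmorphM.
(* A nonzero [P] in the ideal of the slice would vanish at every [eta] over which a point of the
   slice lifts, but [P] and [D] are both nonzero at some such [eta]. *)
- move=> _ [i [b [Ii ->]]] [P [P0 e]].
  have [eta] := mpoly_nonroot (mulf_neq0 P0 Dc0).
  rewrite mevalM mulf_eq0 negb_or => /andP[Peta].
  rewrite -horner_map /= mevalZ -(@mmap_snoc _ _ _ idfun) => Deta.
  have [v [Iv fv]] := lift _ Deta.
  have f'v : (fun j => (f' j).@[v]) = eta.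
    by apply: funext => j; rewrite fv snoc_lift.
  move/eqP: Peta; apply.
  rewrite -[LHS]/(meval eta P) -f'v -meval_psub -e mevalD mevalM Iv // add0r.
  by rewrite mevalB mevalZ meval_psub f'v fv snoc_max subrr mulr0.
exists J; split=> //.
- by move=> x Ix; apply: IJ; exists x, 0; rewrite mul0r addr0.
- move=> P JP; apply/eqP/negPn/negP => P0.
  by apply: (JM _ JP); exists P.
- by apply: IJ; exists 0, 1; rewrite mul1r add0r; split=> //; exact: pideal0.
Qed.

(** Slicing removes one polynomial, the induction hypothesis replaces the others by coordinates on
    the slice, and [indep_extend] adds a coordinate when passing back to [I]. *)
Lemma indep_coords N q (I : set {mpoly K[N]}) (f : 'I_q -> {mpoly K[N]}) :
  prime_ideal I -> indep I f ->
  exists e : 'I_q -> 'I_N, indep I (fun i => 'X_(e i)).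
Proof.
elim: q I f => [|q IHq] I f pI If.
  have e : 'I_0 -> 'I_N by case.
  by exists e; rewrite (_ : (fun i => _) = f) //; apply: funext => -[].
have [c [J [pJ IJ Jf' Ju nIu]]] := indep_slice pI If (oner_neq0 _).
have [e Je] := IHq _ _ pJ Jf'.
have [i Ie] := indep_extend pI pJ IJ Ju nIu Je.
exists (snoc e i); rewrite (_ : (fun j => _) = snoc (fun j => 'X_(e j)) 'X_i) //.
by apply: funext; apply: snoc_ind => [j|]; rewrite ?snoc_lift ?snoc_max.
Qed.

End AffineSpace.

(** * Chains of projective varieties *)

Section Vanishing.
Variable K : closedFieldType.

Definition vanishing N (S : set ('I_N -> K)) : set {mpoly K[N]} :=
  [set p | forall v, S v -> p.@[v] = 0].

Lemma vanishing_mono N (S T : set ('I_N -> K)) : S `<=` T ->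
  vanishing T `<=` vanishing S.
Proof. by move=> ST p Tp v /ST; exact: Tp. Qed.

Lemma indep_mono N q (I J : set {mpoly K[N]}) (g : 'I_q -> {mpoly K[N]}) :
  I `<=` J -> indep J g -> indep I g.
Proof. by move=> IJ Jg p /IJ/Jg. Qed.

Lemma snoc_X N q (e : 'I_q -> 'I_N) i :
  snoc (fun j => 'X_(e j)) 'X_i = (fun j => 'X_(snoc e i j)) :> ('I_q.+1 -> {mpoly K[N]}).
Proof.
by apply: funext; apply: snoc_ind => [j|]; rewrite ?snoc_lift ?snoc_max.
Qed.

Lemma mpolyXU_neq0 N (i : 'I_N) : ('X_i : {mpoly K[N]}) != 0.
Proof.
apply/eqP => /(congr1 (meval (fun=> 1))) /eqP.
by rewrite mevalXU meval0 oner_eq0.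
Qed.

End Vanishing.

Section Cones.
Variables (K : closedFieldType) (n : nat).
Implicit Types (X Y Z A : set (proj K n)) (w : nzvec K n) (v : 'I_n.+1 -> K).
Implicit Types (p q f : {mpoly K[n.+1]}) (J : set {mpoly K[n.+1]}).

Definition coord w : 'I_n.+1 -> K := fun i => val w i 0.

(** The affine cone without its vertex. *)
Definition cone X : set ('I_n.+1 -> K) :=
  [set v | exists w, X (proj_of w) /\ v = coord w].

Lemma cone_coord X w : X (proj_of w) -> cone X (coord w).
Proof. by exists w. Qed.

Lemma nzvec_of v : (exists i, v i != 0) -> exists w, v = coord w.
Proof.
move=> [i vi]; have w0 : \col_i v i != 0.
  by apply: contraNneq vi => /colP/(_ i); rewrite !mxE => ->.
by exists (Sub (\col_i v i) w0); apply: funext => j; rewrite /coord SubK mxE.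
Qed.

Lemma coord_neq0 w : exists i, coord w i != 0.
Proof.
apply/existsP; apply: contraT; rewrite negb_exists => /forallP z.
have := valP w; apply: contraNT => _; apply/eqP/colP => i; rewrite mxE.
by apply/eqP; have := z i; rewrite negbK.
Qed.

Lemma proj_of_scale w w' (c : K) : c != 0 ->
  (forall i, coord w' i = c * coord w i) -> proj_of w' = proj_of w.
Proof.
move=> c0 e; apply/proj_of_eq; exists c => //.
by apply/colP => i; rewrite mxE; exact: e.
Qed.

Lemma cone_scale X v c : cone X v -> c != 0 -> cone X (fun i => c * v i).
Proof.
move=> [w [Xw ->]] c0; have [j wj] := coord_neq0 w.
have [|w' e] := @nzvec_of (fun i => c * coord w i).
  by exists j; rewrite mulf_neq0.
exists w'; split=> //; rewrite (@proj_of_scale w w' c) // => i.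
by rewrite -e.
Qed.

Lemma hvanish_coord d p w : p \is d.-homog ->
  hvanish p (proj_of w) <-> p.@[coord w] = 0.
Proof. exact: hvanish_proj_of. Qed.

Lemma projP (P : proj K n) : exists w, P = proj_of w.
Proof. by exists (Sub (coords P) (coords_neq0 P)); rewrite proj_of_coords. Qed.

Lemma meval_scale d p v c : p \is d.-homog ->
  p.@[fun i => c * v i] = c ^+ d * p.@[v].
Proof.
move=> /dhomogP hp; rewrite !mevalE mulr_sumr; apply: eq_big_seq => m /hp hm.
under eq_bigr do rewrite exprMn.
rewrite big_split /= mulrCA; congr (_ * _); rewrite -hm /= mdegE.
by elim/big_rec2: _ => // i x y _ ->; rewrite exprD.
Qed.

(** The coefficients of [r] are the values at [v] of the homogeneous components of [p]; vanishing on
    a punctured line thus passes to each component. *)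
Lemma restrict_line p v : exists r : {poly K},
  (forall c, r.[c] = p.@[fun i => c * v i]) /\
  (r = 0 -> forall d, (pihomog mdeg d p).@[v] = 0).
Proof.
pose k := msize p.
have pE : p = \sum_(d < k) pihomog mdeg d p by exact: pihomog_partitionE.
exists (\poly_(d < k) (pihomog mdeg d p).@[v]); split=> [c|r0 d].
  rewrite horner_poly [in RHS]pE rmorph_sum /=; apply: eq_bigr => d _.
  by rewrite (meval_scale _ _ (pihomogP _ _ _)) mulrC.
have [dk|kd] := ltnP d k.
  by have := congr1 (fun r : {poly K} => r`_d) r0; rewrite coef_poly dk coef0.
rewrite (_ : pihomog _ _ _ = 0) ?meval0 // pE raddf_sum big1 // => j _.
by rewrite /= (pihomog_ne0 _ (pihomogP _ _ _)) // ltn_eqF // (leq_trans _ kd).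
Qed.

Lemma poly_root_neq0 (r : {poly K}) : (forall c, c != 0 -> r.[c] = 0) -> r = 0.
Proof.
move=> r0; apply/eqP/negPn/negP => rn0.
have : r * 'X != 0 by rewrite mulf_neq0 // polyX_eq0.
move=> /closed_nonrootP[x]; rewrite rootE hornerM hornerX.
by rewrite mulf_eq0 negb_or => /andP[rx x0]; rewrite r0 ?eqxx in rx.
Qed.

Lemma vanishing_line X p w : X (proj_of w) -> vanishing (cone X) p ->
  forall d, (pihomog mdeg d p).@[coord w] = 0.
Proof.
move=> Xw Ip; have [r [re]] := restrict_line p (coord w); apply.
apply: poly_root_neq0 => c c0; rewrite re; apply: Ip; exact: cone_scale (cone_coord Xw) c0.
Qed.

Definition homog_zeros p : set (proj K n) :=
  [set P | forall d, hvanish (pihomog mdeg d p) P].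

Lemma homog_zeros_closed p : zclosed (homog_zeros p).
Proof.
exists [set q | exists d, q = pihomog mdeg d p].
  by move=> _ [d ->]; exists d; exact: pihomogP.
by apply/seteqP; split=> P /= PZ => [_ [d ->]|d]; [exact: PZ | apply: PZ; exists d].
Qed.

Lemma homog_zeros_vanishing X p : X `<=` homog_zeros p -> vanishing (cone X) p.
Proof.
move=> XZ _ [w [Xw ->]]; rewrite [p](@pihomog_partitionE _ _ mdeg _ _ (leqnn _)) rmorph_sum /=.
by rewrite big1 // => d _; apply/(hvanish_coord _ (pihomogP _ _ _)); exact: XZ.
Qed.

(** If [p * q] vanishes on the cone, then on each line of the cone one of the two restrictions is
    zero. Hence [X] is covered by the closed sets [homog_zeros p] and [homog_zeros q]. *)
Lemma cone_prime X : zirreducible X -> prime_ideal (vanishing (cone X)).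
Proof.
move=> [[P XP] irr]; split.
- by move=> v _; rewrite meval0.
- by move=> p q Ip Iq v Xv; rewrite mevalD Ip ?Iq ?addr0.
- by move=> a p Ip v Xv; rewrite mevalM Ip ?mulr0.
- have [w e] := projP P; rewrite e in XP => /(_ _ (cone_coord XP))/eqP.
  by rewrite meval1 oner_eq0.
- move=> p q Ipq.
  have [||] := irr _ _ (homog_zeros_closed p) (homog_zeros_closed q); last 2 first.
  + by move=> /homog_zeros_vanishing; left.
  + by move=> /homog_zeros_vanishing; right.
  move=> Q XQ; have [w e] := projP Q; rewrite e in XQ *.
  have [r [re rz]] := restrict_line p (coord w).
  have [s [se sz]] := restrict_line q (coord w).
  have : r * s = 0.
    apply: poly_root_neq0 => c c0; rewrite hornerM re se -mevalM; apply: Ipq.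
    exact: cone_scale (cone_coord XQ) c0.
  move=> /eqP; rewrite mulf_eq0 => /orP[] /eqP z0; [left|right] => d.
    by apply/(hvanish_coord _ (pihomogP _ _ _)); exact: rz.
  by apply/(hvanish_coord _ (pihomogP _ _ _)); exact: sz.
Qed.

Lemma cone_mono X Y : X `<=` Y -> cone X `<=` cone Y.
Proof. by move=> XY v [w [Xw ->]]; exists w; split=> //; exact: XY. Qed.

Lemma zclosed_separate X Z : zclosed Z -> ~ (X `<=` Z) ->
  exists p, [/\ exists d, p \is d.-homog, vanishing (cone Z) p &
                ~ vanishing (cone X) p].
Proof.
move=> [S Sh ->] /existsNP[P /not_implyP[XP /existsNP[p /not_implyP[Sp nP]]]].
have [d hd] := Sh _ Sp; exists p; split; first by exists d.
  by move=> _ [w [Zw ->]]; apply/(hvanish_coord _ hd); exact: Zw.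
have [w e] := projP P; rewrite e in XP nP => Ip; apply: nP.
by apply/(hvanish_coord _ hd); apply: Ip; exact: cone_coord.
Qed.

(** A point has one independent coordinate, since its cone is a punctured line, and each strict
    inclusion adds one by [indep_extend]. *)
Lemma indep_of_chain X d : irr_chain X d ->
  exists e : 'I_d.+1 -> 'I_n.+1, indep (vanishing (cone X)) (fun i => 'X_(e i)).
Proof.
move=> [Z [Zv Zlt]].
suff H i : (i <= d)%N -> exists e : 'I_i.+1 -> 'I_n.+1,
    indep (vanishing (cone (Z i))) (fun i => 'X_(e i)).
  have [e He] := H _ (leqnn d); exists e; apply: indep_mono He.
  by apply: vanishing_mono; apply: cone_mono; have [] := Zv _ (leqnn d).
elim: i => [|i IHi] id.
  have [[_ [[P ZP] _]] _] := Zv _ id; have [w e] := projP P; rewrite e in ZP.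
  have [i wi] := coord_neq0 w; exists (fun=> i) => p Ip.
  apply/eqP/negPn/negP => p0.
  (* The factor ['X_ord0] makes [eta] nonzero, hence the value of the coordinate [i] at a multiple
     of [coord w]. *)
  have [|eta] := @mpoly_nonroot _ _ (p * 'X_ord0).
    by rewrite mulf_neq0 // mpolyXU_neq0.
  rewrite mevalM mevalXU mulf_eq0 negb_or => /andP[+ eta0]; apply/negP/negPn.
  have c0 : eta ord0 / coord w i != 0 by rewrite mulf_neq0 // invr_eq0.
  have := Ip _ (cone_scale (cone_coord ZP) c0); rewrite meval_psub => <-.
  by apply/eqP/meval_eq => j; rewrite mevalXU divfK // ord1.
have [e ind] := IHi (ltnW id).
have [Zlei nZ] := Zlt _ id.
have [[Zic Ziirr] _] := Zv _ (ltnW id).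
have [[_ Zi1irr] _] := Zv _ id.
have [p [_ Ip nIp]] := zclosed_separate Zic nZ.
have [j Hj] := indep_extend (cone_prime Zi1irr) (cone_prime Ziirr)
  (vanishing_mono (cone_mono Zlei)) Ip nIp ind.
by exists (snoc e j); rewrite -snoc_X.
Qed.

Lemma subset_zclosure A : A `<=` zclosure A.
Proof. by move=> P AP Z [_ AZ]; exact: AZ. Qed.

Lemma zclosure_min A Z : zclosed Z -> A `<=` Z -> zclosure A `<=` Z.
Proof. by move=> Zc AZ P; apply; split. Qed.

Lemma zclosure_closed A : zclosed (zclosure A).
Proof.
exists [set p | (exists d, p \is d.-homog) /\ forall P, A P -> hvanish p P].
  by move=> p [].
apply/seteqP; split=> [P AP p [[d hd] Ap]|P /= AP Z [[S Sh ->] AZ] p Sp].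
  have := AP [set Q | hvanish p Q]; apply; split=> //.
  exists [set p]; first by move=> _ ->; exists d.
  by apply/seteqP; split=> Q /= Qp => [_ ->|] //; exact: Qp.
by apply: AP; split; [exact: Sh | move=> Q /AZ; exact].
Qed.

(** [J] need not be homogeneous, so this image of its affine zeros in projective space need not be
    closed. *)
Definition projective_zeros J : set (proj K n) :=
  [set P | exists w, P = proj_of w /\ forall p, J p -> p.@[coord w] = 0].

Section PrimeZeros.
Variables (J : set {mpoly K[n.+1]}) (i0 : 'I_n.+1).
Hypotheses (pJ : prime_ideal J) (nJX : ~ J 'X_i0).

Lemma prime_zeros_nonroot p : ~ J p ->
  exists w, [/\ projective_zeros J (proj_of w), p.@[coord w] != 0 &
                forall q, J q -> q.@[coord w] = 0].
Proof.
(* The factor ['X_i0] keeps the zero [v] away from the origin. *)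
move=> nJp; have [v [Jv]] := nullstellensatz pJ (npidealM pJ nJp nJX).
rewrite mevalM mevalXU mulf_eq0 negb_or => /andP[pv vi].
have [|w e] := @nzvec_of v; first by exists i0.
by rewrite e in Jv pv; exists w; split=> //; exists w.
Qed.

Lemma vanishing_prime_zeros :
  vanishing (cone (zclosure (projective_zeros J))) `<=` J.
Proof.
move=> p Ip; apply: contrapT => nJp.
have [w [wJ /eqP pw _]] := prime_zeros_nonroot nJp; apply: pw; apply: Ip.
by apply: cone_coord; exact: subset_zclosure.
Qed.

(** Two closed sets that do not contain the closure have equations [p] and [q] outside [J]; a zero
    of [J] where [p * q] is nonzero lies in neither. *)
Lemma prime_zeros_variety : variety (zclosure (projective_zeros J)).
Proof.
split; first exact: zclosure_closed.
split.
  have [w [wJ _ _]] := prime_zeros_nonroot nJX.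
  by exists (proj_of w); exact: subset_zclosure.
move=> Z1 Z2 Z1c Z2c Z12.
have sep Z : zclosed Z -> ~ (zclosure (projective_zeros J) `<=` Z) ->
    exists p, vanishing (cone Z) p /\ ~ J p.
  move=> Zc nZ; have [|p [[d hd] Ip nIp]] := @zclosed_separate (projective_zeros J) _ Zc.
    by move=> /(zclosure_min Zc).
  exists p; split=> // Jp; apply: nIp => _ [w [[w' [e Jw']] ->]].
  apply/(hvanish_coord _ hd); rewrite e; apply/(hvanish_coord _ hd); exact: Jw'.
apply: contrapT => /not_orP[/(sep _ Z1c)[p [Ip nJp]] /(sep _ Z2c)[q [Iq nJq]]].
have [w [wJ + _]] := prime_zeros_nonroot (npidealM pJ nJp nJq).
rewrite mevalM mulf_eq0 negb_or => /andP[/eqP pw /eqP qw].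
have /Z12[Zw|Zw] := subset_zclosure wJ.
  by apply: pw; apply: Ip; exact: cone_coord.
by apply: qw; apply: Iq; exact: cone_coord.
Qed.

End PrimeZeros.

(** Taking [W = 'X_ord0] in [indep_slice] makes [u] a linear form. The zeros of [J] have their
    closure [Z] in the hyperplane [u = 0], which does not contain [X], and [d] coordinates remain
    independent on [Z]. *)
Lemma chain_of_indep X d (e : 'I_d.+1 -> 'I_n.+1) : variety X ->
  indep (vanishing (cone X)) (fun i => 'X_(e i)) -> irr_chain X d.
Proof.
elim: d X e => [|d IHd] X e vX indX.
  by exists (fun=> X); split=> // i _; split.
have pI := cone_prime vX.2.
have X0 : ('X_ord0 : {mpoly K[d.+1]}) != 0 by rewrite mpolyXU_neq0.
have [c [J [pJ IJ indJ]]] := indep_slice pI indX X0.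
rewrite psubX; set u := _ - _ => Ju nIu.
set e' := fun j => e (lift ord_max j).
have nJX : ~ J 'X_(e' ord0).
  move=> JX; have := indJ 'X_ord0; rewrite psubX => /(_ JX)/eqP.
  by rewrite (negbTE X0).
pose Z := zclosure (projective_zeros J).
have hu : u \is 1.-homog.
  by apply: rpredB; [|apply: rpredZ]; rewrite dhomogX /= mdeg1.
have sZ P : Z P -> X P.
  have [[S Sh eX] _] := vX; apply: zclosure_min; first exact: vX.1.
  move=> _ [w [-> Jw]]; rewrite eX => p Sp; have [k hk] := Sh _ Sp.
  apply/(hvanish_coord _ hk); apply: Jw; apply: IJ => _ [w' [Xw' ->]].
  by apply/(hvanish_coord _ hk); rewrite eX in Xw'; exact: Xw'.
have XZ : ~ (X `<=` Z).
  move=> XZ; apply: nIu => _ [w [/XZ Zw ->]].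
  have /(_ _ Zw) /(_ 1%N) : Z `<=` homog_zeros u.
    apply: zclosure_min; first exact: homog_zeros_closed.
    move=> _ [w' [-> Jw']] k; apply/(hvanish_coord _ (pihomogP _ _ _)).
    have [->|k1] := eqVneq k 1%N; first by rewrite pihomog_dE //; exact: Jw'.
    by rewrite (pihomog_ne0 _ hu) ?meval0 // eq_sym.
  by rewrite pihomog_dE // => /(hvanish_coord _ hu).
have [|z [zv zlt]] := IHd Z e' (prime_zeros_variety pJ nJX).
  exact: indep_mono (vanishing_prime_zeros pJ nJX) indJ.
exists (fun i => if (i <= d)%N then z i else X); split=> i.
  move=> _; case: (leqP i d) => [id|_]; last by split.
  by have [vz zZ] := zv _ id; split=> // P /zZ; exact: sZ.
rewrite ltnS => id; have [->|di] := eqVneq i d; last first.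
  have {}di : (i < d)%N by rewrite ltn_neqAle di.
  by rewrite id di; exact: zlt.
rewrite leqnn ltnn; have [_ zZ] := zv _ (leqnn d); split.
  by move=> P /zZ; exact: sZ.
by move=> Xz; apply: XZ => P /Xz; exact: zZ.
Qed.

End Cones.

(** * Products of affine sets *)

Section Polyfun.
Variable K : closedFieldType.

Definition polyfun N (h : ('I_N -> K) -> K) :=
  exists p : {mpoly K[N]}, forall v, h v = p.@[v].

Lemma polyfun_cst N c : polyfun (fun _ : 'I_N -> K => c).
Proof. by exists c%:MP => v; rewrite mevalC. Qed.

Lemma polyfun_coord N i : polyfun (fun v : 'I_N -> K => v i).
Proof. by exists 'X_i => v; rewrite mevalXU. Qed.

Lemma polyfunD N (f g : ('I_N -> K) -> K) :
  polyfun f -> polyfun g -> polyfun (fun v => f v + g v).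
Proof. by move=> [p pE] [q qE]; exists (p + q) => v; rewrite mevalD pE qE. Qed.

Lemma polyfunM N (f g : ('I_N -> K) -> K) :
  polyfun f -> polyfun g -> polyfun (fun v => f v * g v).
Proof. by move=> [p pE] [q qE]; exists (p * q) => v; rewrite mevalM pE qE. Qed.

Lemma polyfun_sum N (I : Type) (r : seq I) (P : pred I) (F : I -> ('I_N -> K) -> K) :
  (forall i, polyfun (F i)) -> polyfun (fun v => \sum_(i <- r | P i) F i v).
Proof.
move=> pF; elim: r => [|i r IHr].
  by under [fun _ => _]funext => v do rewrite big_nil; exact: polyfun_cst.
under [fun _ => _]funext => v do rewrite big_cons.
by case: (P i) => //; exact: polyfunD.
Qed.

Lemma polyfun_prod N (I : Type) (r : seq I) (P : pred I) (F : I -> ('I_N -> K) -> K) :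
  (forall i, polyfun (F i)) -> polyfun (fun v => \prod_(i <- r | P i) F i v).
Proof.
move=> pF; elim: r => [|i r IHr].
  by under [fun _ => _]funext => v do rewrite big_nil; exact: polyfun_cst.
under [fun _ => _]funext => v do rewrite big_cons.
by case: (P i) => //; exact: polyfunM.
Qed.

Lemma polyfun_psub N q (F : 'I_q -> ('I_N -> K) -> K) :
  (forall i, polyfun (F i)) -> exists f : 'I_q -> {mpoly K[N]},
    forall (p : {mpoly K[q]}) v, (psub f p).@[v] = p.@[F^~ v].
Proof.
move=> /boolp.choice[f fE]; exists f => p v; rewrite meval_psub.
by apply: meval_eq => i; rewrite fE.
Qed.

Lemma polyfun_comp N q (p : {mpoly K[q]}) (F : 'I_q -> ('I_N -> K) -> K) :
  (forall i, polyfun (F i)) -> polyfun (fun v => p.@[F^~ v]).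
Proof. by move=> /polyfun_psub[f fE]; exists (psub f p) => v; rewrite fE. Qed.

Lemma nvanishingP N (S : set ('I_N -> K)) p :
  ~ vanishing S p <-> exists v, S v /\ p.@[v] != 0.
Proof.
split=> [/existsNP[v /not_implyP[Sv /eqP pv]]|[v [Sv pv]] Sp]; first by exists v.
by rewrite Sp ?eqxx in pv.
Qed.

Lemma vanishing_prime N (S : set ('I_N -> K)) : S !=set0 ->
  (forall p q : {mpoly K[N]}, (exists v, S v /\ p.@[v] != 0) ->
    (exists v, S v /\ q.@[v] != 0) ->
    exists v, [/\ S v, p.@[v] != 0 & q.@[v] != 0]) ->
  prime_ideal (vanishing S).
Proof.
move=> [v0 Sv0] Sirr; split.
- by move=> v _; rewrite meval0.
- by move=> p q Ip Iq v Sv; rewrite mevalD Ip ?Iq ?addr0.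
- by move=> a p Ip v Sv; rewrite mevalM Ip ?mulr0.
- by move=> /(_ _ Sv0)/eqP; rewrite meval1 oner_eq0.
move=> p q Ipq; apply: contrapT => /not_orP[/nvanishingP Ip /nvanishingP Iq].
have [v [Sv pv qv]] := Sirr _ _ Ip Iq.
by have /eqP := Ipq _ Sv; rewrite mevalM mulf_eq0 (negbTE pv) (negbTE qv).
Qed.

Lemma prime_common_nonroot N (S : set ('I_N -> K)) (p q : {mpoly K[N]}) :
  prime_ideal (vanishing S) -> (exists v, S v /\ p.@[v] != 0) ->
  (exists v, S v /\ q.@[v] != 0) ->
  exists v, [/\ S v, p.@[v] != 0 & q.@[v] != 0].
Proof.
move=> pS /nvanishingP Ip /nvanishingP Iq.
have /nvanishingP[v [Sv]] := npidealM pS Ip Iq.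
by rewrite mevalM mulf_eq0 negb_or => /andP[pv qv]; exists v.
Qed.

End Polyfun.

Definition upd (I : eqType) (T : Type) (f : I -> T) (j : I) (x : T) : I -> T :=
  fun l => if l == j then x else f l.

(** An arbitrary tuple satisfying an open condition [Q] is moved into the product of the [S j] one
    factor at a time. *)
Lemma replace_factors k (T : Type) (S : 'I_k -> set T) (Q : ('I_k -> T) -> Prop) :
  (forall x j, Q x -> exists t, S j t /\ Q (upd x j t)) ->
  forall x, Q x -> exists y, (forall j, S j (y j)) /\ Q y.
Proof.
move=> step x Qx.
suff H i : (i <= k)%N -> exists y, (forall j : 'I_k, (j < i)%N -> S j (y j)) /\ Q y.
  by have [y [Sy Qy]] := H _ (leqnn k); exists y; split=> // j; exact: Sy.
elim: i => [|i IHi] ik; first by exists x.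
have [y [Sy Qy]] := IHi (ltnW ik).
have [t [St Qt]] := step _ (Ordinal ik) Qy.
exists (upd y (Ordinal ik) t); split=> // j ji; rewrite /upd.
case: eqP => [-> //|ne]; apply: Sy.
rewrite ltn_neqAle -ltnS ji andbT; apply/eqP => e; apply: ne.
exact: val_inj.
Qed.

Section Products.
Variables (K : closedFieldType) (k a : nat).
Implicit Types (S : 'I_k -> set ('I_a -> K)).

Let N := #|{: 'I_k * 'I_a}|.

Definition flat (xi : 'I_k -> 'I_a -> K) : 'I_N -> K :=
  fun t => xi (enum_val t).1 (enum_val t).2.

Definition unflat (x : 'I_N -> K) : 'I_k -> 'I_a -> K :=
  fun j i => x (enum_rank (j, i)).

Lemma flatK : cancel flat unflat.
Proof.
by move=> xi; apply: funext => j; apply: funext => i; rewrite /unflat /flat enum_rankK.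
Qed.

Lemma unflatK : cancel unflat flat.
Proof.
by move=> x; apply: funext => t; rewrite /unflat /flat -surjective_pairing enum_valK.
Qed.

Definition product_set S : set ('I_N -> K) := [set x | forall j, S j (unflat x j)].

Lemma polyfun_upd (F : ('I_N -> K) -> K) xi j :
  polyfun F -> polyfun (fun v => F (flat (upd xi j v))).
Proof.
move=> [p pE]; under [fun _ => _]funext => v do rewrite pE.
apply: polyfun_comp => t; rewrite /flat /upd; case: eqP => _.
  exact: polyfun_coord.
exact: polyfun_cst.
Qed.

(** A nonroot of [p] and a nonroot of [q] are made equal one factor at a time: with the other
    factors frozen, both are nonzero somewhere on [S j], hence at a common point of [S j]. *)
Lemma product_set_prime S : (forall j, prime_ideal (vanishing (S j))) ->
  prime_ideal (vanishing (product_set S)).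
Proof.
move=> pS; apply: vanishing_prime.
  have /boolp.choice[xi Sxi] j : exists v, S j v.
    by have /nvanishingP[v [Sv _]] := pideal1 (pS j); exists v.
  by exists (flat xi) => j; rewrite flatK.
move=> p q [v [Sv pv]] [w [Sw qw]].
pose Q (x : 'I_k -> ('I_a -> K) * ('I_a -> K)) :=
  [/\ forall j, S j (x j).1 /\ S j (x j).2, p.@[flat (fun j => (x j).1)] != 0 &
      q.@[flat (fun j => (x j).2)] != 0].
suff step x j : Q x -> exists t, t.1 = t.2 /\ Q (upd x j t).
  have [|x [xe [Sx px qx]]] := replace_factors (S := fun=> [set t | t.1 = t.2])
      step (x := fun j => (unflat v j, unflat w j)).
    have unflatK' y : flat (fun j => unflat y j) = y := unflatK y.
    by split=> /= [j||]; rewrite ?unflatK'.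
  exists (flat (fun j => (x j).1)); split=> //.
    by move=> j; rewrite flatK; have [] := Sx j.
  by rewrite (_ : (fun _ => _) = (fun j => (x j).2)) //; apply: funext => j; exact: xe.
move=> [Sx px qx].
have [f fE] := @polyfun_upd (fun y => p.@[y]) (fun j => (x j).1) j (ex_intro _ p (fun=> erefl)).
have [g gE] := @polyfun_upd (fun y => q.@[y]) (fun j => (x j).2) j (ex_intro _ q (fun=> erefl)).
have updid (xi : 'I_k -> 'I_a -> K) : upd xi j (xi j) = xi.
  by apply: funext => l; rewrite /upd; case: eqP => // ->.
have [||t [St ft gt]] := @prime_common_nonroot _ _ _ f g (pS j).
- exists (x j).1; split; first by have [] := Sx j.
  by rewrite -fE (updid (fun j => (x j).1)).
- exists (x j).2; split; first by have [] := Sx j.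
  by rewrite -gE (updid (fun j => (x j).2)).
exists (t, t); split=> //; split.
- by move=> l; rewrite /upd; case: eqP => [->|_] //; exact: Sx.
- rewrite (_ : (fun _ => _) = upd (fun j => (x j).1) j t) ?fE //.
  by apply: funext => l; rewrite /upd; case: eqP.
- rewrite (_ : (fun _ => _) = upd (fun j => (x j).2) j t) ?gE //.
  by apply: funext => l; rewrite /upd; case: eqP.
Qed.

(** A relation on one factor is also a relation on the product. This bounds how many of the
    independent coordinates of a product can come from one factor. *)
Lemma indep_factor S q (e : 'I_q -> 'I_N) j t (sigma : 'I_t -> 'I_q) :
  (forall l, S l !=set0) ->
  indep (vanishing (product_set S)) (fun i => 'X_(e i)) -> injective sigma ->
  (forall r, (enum_val (e (sigma r))).1 = j) ->
  indep (vanishing (S j)) (fun r => 'X_((enum_val (e (sigma r))).2)).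
Proof.
move=> S0 inde inj_s sj p Ip; apply/eqP/negPn/negP => p0.
have [eta peta] := mpoly_nonroot p0.
pose p' : {mpoly K[q]} := psub (fun r => 'X_(sigma r)) p.
have p'0 : p' = 0.
  apply: inde => x Sx; rewrite !meval_psub -(Ip _ (Sx j)) meval_psub.
  apply: meval_eq => r; rewrite !mevalXU -{1}(unflatK x) /flat.
  by rewrite sj.
have := peta; rewrite (_ : eta = fun r => ('X_(sigma r) : {mpoly K[q]}).@[fun i =>
  if [pick r | sigma r == i] is Some r then eta r else 0]).
  by rewrite -meval_psub -/p' p'0 meval0 eqxx.
apply: funext => r; rewrite mevalXU; case: pickP => [r' /eqP/inj_s -> //|].
by move=> /(_ r); rewrite eqxx.
Qed.

End Products.

(** * Upper bound *)

Definition dense_image (K : closedFieldType) (T : Type) (S : set T) q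
    (h : T -> 'I_q -> K) :=
  forall p : {mpoly K[q]}, p != 0 -> exists x, S x /\ p.@[h x] != 0.

Lemma dense_image_indep (K : closedFieldType) N (S : set ('I_N -> K)) q
    (f : 'I_q -> {mpoly K[N]}) :
  dense_image S (fun v i => (f i).@[v]) <-> indep (vanishing S) f.
Proof.
split=> [df p Ip|indf p p0].
  apply/eqP/negPn/negP => /df[v [Sv]].
  by rewrite -meval_psub Ip ?eqxx.
have /nvanishingP[v [Sv]] : ~ vanishing S (psub f p).
  by move=> /indf/eqP; rewrite (negbTE p0).
by rewrite meval_psub; exists v.
Qed.

Lemma lift_max_widen n (i : 'I_n) : widen_ord (leqnSn n) i = lift ord_max i.
Proof. by apply: val_inj; rewrite /= /bump leqNgt ltn_ord. Qed.

Lemma prod_snoc (R : comNzRingType) n (f : 'I_n -> R) x :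
  \prod_(j < n.+1) snoc f x j = (\prod_(j < n) f j) * x.
Proof.
rewrite big_ord_recr /= snoc_max; congr (_ * _); apply: eq_bigr => j _.
by rewrite lift_max_widen snoc_lift.
Qed.

(** * Hadamard products on the level of cones *)

Section HadamardProducts.
Variables (K : closedFieldType) (n m : nat).
Implicit Types (A : 'I_m -> 'M[K]_n.+1) (X : 'I_m.+1 -> set (proj K n)).
Implicit Types (xi : 'I_m.+1 -> 'I_n.+1 -> K).

(** The matrices are arbitrary, because the lower bound starts from possibly singular ones. *)
Definition move_factor A (j : 'I_m.+1) (v : 'I_n.+1 -> K) (i : 'I_n.+1) : K :=
  if unlift ord_max j is Some l then \sum_b A l i b * v b else v i.

Definition hprod A xi i : K := \prod_j move_factor A j (xi j) i.

(** Since [w] is a nonzero vector, undefined products are left out. *)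
Definition himage A X : set (proj K n) :=
  [set Q | exists xi w, [/\ forall j, cone (X j) (xi j), Q = proj_of w &
                            coord w = hprod A xi]].

Definition move_nzvec (A : 'I_m -> glmx K n) (j : 'I_m.+1) (w : nzvec K n) :
  nzvec K n := if unlift ord_max j is Some l then gl_act (A l) w else w.

Lemma coord_move_nzvec (A : 'I_m -> glmx K n) j w :
  coord (move_nzvec A j w) = move_factor (fun l => val (A l)) j (coord w).
Proof.
apply: funext => i; rewrite /coord /move_nzvec /move_factor.
case: unlift => [l|] //; rewrite val_gl_act mxE.
by apply: eq_bigr.
Qed.

Lemma hadamard_translate (A : 'I_m -> glmx K n) X :
  hadamard (translate (fun j => pgl_of (A j)) X) =
  zclosure (himage (fun j => val (A j)) X).
Proof.
have colE (w : 'I_m.+1 -> nzvec K n) i :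
    (\col_a \prod_(j < m.+1) val (move_nzvec A j (w j)) a 0) i 0 =
    hprod (fun j => val (A j)) (fun j => coord (w j)) i.
  rewrite mxE; apply: eq_bigr => j _.
  by rewrite -coord_move_nzvec.
have transE j w : X j (proj_of w) ->
    translate (fun j => pgl_of (A j)) X j (proj_of (move_nzvec A j w)).
  move=> Xw; rewrite /translate /move_nzvec; case: unlift => [l|] //.
  by exists (proj_of w) => //; rewrite pgl_act_of.
rewrite /hadamard; congr zclosure; apply/seteqP; split=> Q.
  move=> [P [XP hP]].
  have /boolp.choice[w wP] j : exists w, X j (proj_of w) /\
      P j = proj_of (move_nzvec A j w).
    have := XP j; rewrite /translate /move_nzvec; case: unlift => [l|].
      by move=> [R XR <-]; have [w e] := projP R; exists w; rewrite -e e pgl_act_of -e.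
    by have [w e] := projP (P j); exists w; rewrite -e.
  have eP : P = fun j => proj_of (move_nzvec A j (w j)).
    by apply: funext => j; have [] := wP j.
  move: hP; rewrite eP hadamard_pt_proj_of.
  case: insubP => //= u _ eu [<-].
  exists (fun j => coord (w j)), u; split=> //.
    by move=> j; apply: cone_coord; have [] := wP j.
  by apply: funext => i; rewrite -colE -eu.
move=> [xi [u [cxi -> eu]]].
have /boolp.choice[w wP] j : exists w, X j (proj_of w) /\ xi j = coord w.
  exact: cxi.
have exi : xi = fun j => coord (w j) by apply: funext => j; have [] := wP j.
exists (fun j => proj_of (move_nzvec A j (w j))); split.
  by move=> j; apply: transE; have [] := wP j.
rewrite hadamard_pt_proj_of (_ : \col_i _ = val u) ?valK //.
apply/colP => i; rewrite colE -exi -eu.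
by [].
Qed.

Lemma move_factorZ A j c v i :
  move_factor A j (fun b => c * v b) i = c * move_factor A j v i.
Proof.
rewrite /move_factor; case: unlift => [l|] //; rewrite mulr_sumr.
by apply: eq_bigr => b _; rewrite mulrCA.
Qed.

Lemma hprodZ A xi (c : 'I_m.+1 -> K) i :
  hprod A (fun j b => c j * xi j b) i = (\prod_j c j) * hprod A xi i.
Proof.
by rewrite /hprod -big_split /=; apply: eq_bigr => j _; rewrite move_factorZ.
Qed.

Lemma cone_himage A X v : cone (himage A X) v ->
  exists xi, (forall j, cone (X j) (xi j)) /\ v = hprod A xi.
Proof.
move=> [w [[xi [w0 [cxi /proj_of_eq[c c0 e] e0]]] ->]].
(* The scalar between the two representatives is absorbed in the last factor. *)
pose d := snoc (fun=> 1 : K) c : 'I_m.+1 -> K.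
exists (fun j b => d j * xi j b); split.
  move=> j; apply: cone_scale => //.
  by move: j; apply: snoc_ind => [j|]; rewrite /d ?snoc_lift ?snoc_max ?oner_eq0.
apply: funext => i; rewrite hprodZ prod_snoc big1 // mul1r -e0 /coord e.
by rewrite mxE.
Qed.

Lemma vanishing_zclosure (Y : set (proj K n)) :
  vanishing (cone Y) `<=` vanishing (cone (zclosure Y)).
Proof.
move=> p Ip; apply: homog_zeros_vanishing; apply: zclosure_min.
  exact: homog_zeros_closed.
move=> Q YQ d; have [w e] := projP Q; rewrite e in YQ *.
by apply/(hvanish_coord _ (pihomogP _ _ _)); exact: vanishing_line Ip d.
Qed.

Lemma polyfun_hprod A i :
  polyfun (fun x : 'I_#|{: 'I_m.+1 * 'I_n.+1}| -> K => hprod A (unflat x) i).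
Proof.
apply: polyfun_prod => j; rewrite /move_factor; case: unlift => [l|].
  apply: polyfun_sum => b; apply: polyfunM; first exact: polyfun_cst.
  exact: polyfun_coord.
exact: polyfun_coord.
Qed.

Lemma variety_cone X : (forall j, variety (X j)) ->
  forall j, prime_ideal (vanishing (cone (X j))).
Proof. by move=> vX j; apply: cone_prime; have [] := vX j. Qed.

Lemma variety_cone_nonroot X : (forall j, variety (X j)) ->
  exists (c : 'I_m.+1 -> 'I_n.+1) xi,
    forall j, cone (X j) (xi j) /\ xi j (c j) != 0.
Proof.
move=> vX.
have /boolp.choice[f fP] j : exists t : 'I_n.+1 * ('I_n.+1 -> K),
    cone (X j) t.2 /\ t.2 t.1 != 0.
  have [_ [[P XP] _]] := vX j; have [w e] := projP P.
  have [i wi] := coord_neq0 w; exists (i, coord w); split=> //=.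
  by apply: cone_coord; rewrite -e.
by exists (fun j => (f j).1), (fun j => (f j).2).
Qed.

Section Upper.
Variables (X : 'I_m.+1 -> set (proj K n)) (A : 'I_m -> 'M[K]_n.+1).
Hypothesis vX : forall j, variety (X j).

Let Xi := product_set (fun j => cone (X j)).

Let pXi : prime_ideal (vanishing Xi).
Proof. exact/product_set_prime/variety_cone. Qed.

(* Rescaling the factors [xi j], [j < m], by arbitrary [mu j] and the last one
   by the inverse of their product leaves the Hadamard product unchanged. *)
Lemma dense_torus s (h : 'I_s -> 'I_n.+1) (c : 'I_m.+1 -> 'I_n.+1) xi0 :
  (forall j, cone (X j) (xi0 j) /\ xi0 j (c j) != 0) ->
  dense_image Xi (fun x i => hprod A (unflat x) (h i)) ->
  dense_image Xi (fun x (i : 'I_(s + m)) => match split i with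
    | inl i => hprod A (unflat x) (h i)
    | inr j => unflat x (lift ord_max j) (c (lift ord_max j)) end).
Proof.
move=> xi0P dh p p0.
have [|eta] := @mpoly_nonroot _ _ (p * \prod_(j < m) 'X_(rshift s j)).
  by rewrite mulf_neq0 //; apply/prodf_neq0 => j _; exact: mpolyXU_neq0.
rewrite mevalM rmorph_prod /= mulf_eq0 negb_or => /andP[peta].
under eq_bigr do rewrite mevalXU; move=> /prodf_neq0 lam0.
pose lam j := eta (rshift s j).
pose p' : {mpoly K[s]} := psub (fun i => match split i with
  inl i => 'X_i | inr j => (lam j)%:MP end) p.
have p'E v : p'.@[v] =
    p.@[fun i => match split i with inl i => v i | inr j => lam j end].
  rewrite meval_psub; apply: meval_eq => i.
  by case: split => j; rewrite ?mevalXU ?mevalC.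
have [|x1 [Xix1 p'x1]] := dh p'.
  have : p'.@[fun i => eta (lshift m i)] != 0.
    rewrite p'E (_ : (fun _ => _) = eta) //; apply: funext => i.
    by case: split_ordP => j ->.
  by apply: contraNneq => ->; rewrite meval0.
have [f fE] : polyfun (fun x : 'I_#|{: 'I_m.+1 * 'I_n.+1}| -> K =>
    p'.@[fun i => hprod A (unflat x) (h i)]).
  by apply: polyfun_comp => i; exact: polyfun_hprod.
have [g gE] : polyfun (fun x : 'I_#|{: 'I_m.+1 * 'I_n.+1}| -> K =>
    \prod_(j < m) unflat x (lift ord_max j) (c (lift ord_max j))).
  by apply: polyfun_prod => j; exact: polyfun_coord.
have [||x [Xix]] := prime_common_nonroot (p := f) (q := g) pXi.
- by exists x1; rewrite -fE.
- exists (flat xi0); split; first by move=> j; rewrite flatK; have [] := xi0P j.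
  by rewrite -gE flatK; apply/prodf_neq0 => j _; have [] := xi0P (lift ord_max j).
rewrite -fE -gE => p'x /prodf_neq0 cx0.
pose mu j := lam j / unflat x (lift ord_max j) (c (lift ord_max j)).
have mu0 j : mu j != 0 by rewrite mulf_neq0 ?invr_eq0 ?cx0 //; exact: lam0.
pose d := snoc mu (\prod_j mu j)^-1.
have d0 j : d j != 0.
  move: j; apply: snoc_ind => [j|]; rewrite /d ?snoc_lift ?snoc_max //.
  by rewrite invr_eq0; apply/prodf_neq0 => j _.
exists (flat (fun j b => d j * unflat x j b)); split.
  by move=> j; rewrite flatK; apply: cone_scale => //; exact: Xix.
rewrite flatK; move: p'x; rewrite p'E; congr (_.@[_] != 0); apply: funext => i.
case: split => [a|j].
  rewrite hprodZ prod_snoc divff ?mul1r //.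
  by apply/prodf_neq0 => j _.
by rewrite /d snoc_lift divfK // cx0.
Qed.

(** By [dense_torus] there are [s.+1 + m] independent functions on the product of the cones. Factor
    [j] accounts for at most [(D j).+1] of them, and the sum of these bounds is the sum of the [D j]
    plus [m.+1]. *)
Lemma hadamard_dim_le (D : 'I_m.+1 -> nat) s :
  (forall j d, irr_chain (X j) d -> (d <= D j)%N) ->
  irr_chain (zclosure (himage A X)) s -> (s <= \sum_j D j)%N.
Proof.
move=> dimX /indep_of_chain[h indh].
have dh : dense_image Xi (fun x i => hprod A (unflat x) (h i)).
  move=> p p0; apply: contrapT => np; move/eqP: p0; apply.
  apply: indh; apply: vanishing_zclosure => v /cone_himage[xi [cxi ->]].
  apply/eqP/negPn/negP => pxi; apply: np; exists (flat xi).
  rewrite flatK; split; first by move=> j; rewrite flatK.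
  move: pxi; rewrite meval_psub; congr (_ != _).
  by apply: meval_eq => i; rewrite mevalXU.
have [c [xi0 xi0P]] := variety_cone_nonroot vX.
have dt := dense_torus xi0P dh.
pose F (i : 'I_(s.+1 + m)) (x : 'I_#|{: 'I_m.+1 * 'I_n.+1}| -> K) :=
  match split i with
    | inl i => hprod A (unflat x) (h i)
    | inr j => unflat x (lift ord_max j) (c (lift ord_max j)) end.
have /boolp.choice[f fE] i : polyfun (F i).
  rewrite /F; case: split => [a|j]; first exact: polyfun_hprod.
  exact: polyfun_coord.
(* Passing to coordinates attaches each independent function to a single factor, so that they can be
   counted factor by factor. *)
have [|e inde] := @indep_coords _ _ _ _ f pXi.
  apply/dense_image_indep => p /dt[x [Xix px]]; exists x; split=> //.
  by move: px; congr (_ != _); apply: meval_eq => i; rewrite -fE.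
have S0 j : cone (X j) !=set0 by exists (xi0 j); have [] := xi0P j.
pose T j := [pred i | (enum_val (e i)).1 == j].
have cardT j : (#|T j| <= (D j).+1)%N.
  have ind : indep (vanishing (cone (X j)))
      (fun r : 'I_#|T j| => 'X_((enum_val (e (enum_val r))).2)).
    apply: (indep_factor S0 inde) => [|r]; first exact: enum_val_inj.
    by have := enum_valP r; rewrite inE => /eqP.
  have bound t (e' : 'I_t -> 'I_n.+1) :
      indep (vanishing (cone (X j))) (fun r => 'X_(e' r)) -> (t <= (D j).+1)%N.
    by case: t e' => // t e' /(chain_of_indep (vX j)); exact: dimX.
  exact: bound ind.
have : (s.+1 + m <= \sum_j (D j).+1)%N.
  rewrite -{1}(card_ord (s.+1 + m)) -sum1_card.
  rewrite (partition_big (fun i => (enum_val (e i)).1) predT) //=.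
  apply: leq_sum => j _; apply: leq_trans (cardT j).
  by rewrite sum1_card; apply: eq_leq; exact: eq_card.
under [X in (_ <= X)%N -> _]eq_bigr do rewrite -addn1.
by rewrite big_split /= sum1_card card_ord addSnnS leq_add2r.
Qed.

End Upper.

End HadamardProducts.

(** * Lower bound *)

(** It serves to match as many rows as possible with the independent coordinates of the first
    factors. *)
Lemma partial_matching (T U : finType) (A : {set T}) : exists f : T -> option U,
  [/\ forall x, f x -> x \in A, (minn #|A| #|U| <= #|[set x | f x]%SET|)%N &
      forall x y, f x -> f x = f y -> x = y].
Proof.
pose k := minn #|A| #|U|; pose s := enum A; pose t := map Some (enum U).
have ks : (k <= size s)%N by rewrite -cardE geq_minl.
have kt : (k <= size t)%N by rewrite size_map -cardE geq_minr.
pose f x := if (index x s < k)%N then nth None t (index x s) else None.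
have fsome x : f x -> x \in A /\ (index x s < k)%N.
  rewrite /f; case: ltnP => // xk _; split=> //.
  by rewrite -mem_enum -index_mem (leq_trans xk).
have uniqt : uniq t by rewrite map_inj_uniq ?enum_uniq // => x y [].
exists f; split.
- by move=> x /fsome[].
- rewrite -/k -[k](size_takel ks) -(card_uniqP (take_uniq k (enum_uniq A))).
  apply: subset_leq_card; apply/fintype.subsetP => x xs; rewrite inE /f.
  have xk : (index x s < k)%N.
    have := xs; rewrite -index_mem size_takel // => lt.
    rewrite -(cat_take_drop k s) index_cat xs //.
  rewrite xk.
  by have /(mem_nth None)/mapP[u _ ->] := leq_trans xk kt.
- move=> x y fx fxy; have [xA xk] := fsome _ fx.
  have [yA yk] : y \in A /\ (index y s < k)%N by apply: fsome; rewrite -fxy.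
  move: fxy; rewrite /f xk yk => /eqP.
  rewrite nth_uniq ?(leq_trans _ kt) // => /eqP.
  by move=> exy; apply: (index_inj x _ _ exy); rewrite mem_enum.
Qed.

Section IndepFacts.
Variables (K : closedFieldType) (N : nat) (S : set ('I_N -> K)) (t : nat).
Variable e : 'I_t -> 'I_N.
Hypothesis inde : indep (vanishing S) (fun i => 'X_(e i)).

Lemma indep_inj : injective e.
Proof.
move=> r r' err; apply/eqP/negPn/negP => rr.
have H : vanishing S (psub (fun i => 'X_(e i)) ('X_r - 'X_r')).
  by rewrite rmorphB /= !psubX err subrr => v _; rewrite meval0.
have /(congr1 (meval (fun i => (i == r)%:R))) := inde H.
rewrite mevalB !mevalXU meval0 eqxx eq_sym (negbTE rr) subr0 => /eqP.
by rewrite oner_eq0.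
Qed.

(** Such a [p] is a polynomial in the independent coordinates alone, so a nonroot anywhere yields a
    nonroot in [S]. *)
Lemma indep_nonroot (p : {mpoly K[N]}) w :
  (forall v v', (forall r, v (e r) = v' (e r)) -> p.@[v] = p.@[v']) ->
  p.@[w] != 0 -> exists v, S v /\ p.@[v] != 0.
Proof.
move=> dep pw.
pose P : {mpoly K[t]} := psub
  (fun i => if [pick r | e r == i] is Some r then 'X_r else 0) p.
have PE v : P.@[fun r => v (e r)] = p.@[v].
  rewrite meval_psub; apply: dep => r; case: pickP => [r' /eqP er'|/(_ r)].
    by rewrite mevalXU er'.
  by rewrite eqxx.
have /nvanishingP[v [Sv]] : ~ vanishing S (psub (fun i => 'X_(e i)) P).
  move=> /inde P0; have := PE w; rewrite P0 meval0 => pw0.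
  by rewrite -pw0 eqxx in pw.
rewrite meval_psub => Pv; exists v; split=> //; move: Pv.
by rewrite -PE; congr (_ != _); apply: meval_eq => r; rewrite mevalXU.
Qed.

End IndepFacts.

Section LineSpecialization.
Variables (K : closedFieldType) (s : nat) (T : Type) (S : set T).
Variable z : K -> T -> 'I_s -> K.
Hypothesis zpoly : forall x i, exists r : {poly K}, forall u, z u x i = r.[u].
Hypothesis dense0 : dense_image S (z 0).

(* The constant term in [u] vanishes on the dense image at [u = 0]; then divide
   by [u]. *)
Lemma line_specialization (Q : {poly {mpoly K[s]}}) :
  (forall u x, S x -> Q.[u%:MP].@[z u x] = 0) -> Q = 0.
Proof.
elim/poly_ind: Q => // q c IHq Q0.
have c0 : c = 0.
  apply/eqP/negPn/negP => /dense0[x [Sx]].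
  have := Q0 0 x Sx; rewrite hornerMXaddC mpolyC0 mulr0 add0r => ->.
  by rewrite eqxx.
rewrite c0 addr0 IHq ?mul0r // => u x Sx.
have /boolp.choice[r rE] := zpoly x.
pose R : {poly K} := (map_poly (mmap polyC r) q).['X].
have RE u' : R.[u'] = q.[u'%:MP].@[z u' x].
  have -> : R.[u'] = (map_poly (horner_eval u' \o mmap polyC r) q).['X.[u']].
    by rewrite map_poly_comp; exact: (esym (horner_map (horner_eval u') _ 'X)).
  rewrite hornerX -horner_map /= mevalC; congr _.[_]; apply: eq_map_poly => p.
  apply: (@mpoly_rmorph_eq _ _ _ (horner_eval u' \o mmap polyC r)
     (meval (z u' x))) => [d|i] /=.
    by rewrite mmapC mevalC /horner_eval hornerC.
  by rewrite mmapX mmap1U mevalXU /horner_eval rE.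
rewrite -RE (_ : R = 0) ?horner0 //; apply: poly_root_neq0 => u' u'0.
have := Q0 u' x Sx; rewrite c0 addr0 hornerM hornerX mevalM mevalC -RE => /eqP.
by rewrite mulf_eq0 (negbTE u'0) orbF => /eqP.
Qed.

End LineSpecialization.

Definition join (K : Type) (M N : nat) (g : 'I_M -> K) (x : 'I_N -> K) :
    'I_(M + N) -> K :=
  fun i => match split i with inl a => g a | inr b => x b end.

Lemma join_lshift (K : Type) M N (g : 'I_M -> K) (x : 'I_N -> K) a :
  join g x (lshift N a) = g a.
Proof. by rewrite /join; case: split_ordP => b /eqP; rewrite ?eq_lshift ?eq_lrshift // => /eqP ->. Qed.

Lemma join_rshift (K : Type) M N (g : 'I_M -> K) (x : 'I_N -> K) b :
  join g x (rshift M b) = x b.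
Proof. by rewrite /join; case: split_ordP => a /eqP; rewrite ?eq_rshift ?eq_rlshift // => /eqP ->. Qed.

Lemma join_shift (K : Type) M N (v : 'I_(M + N) -> K) :
  join (fun a => v (lshift N a)) (fun b => v (rshift M b)) = v.
Proof. by apply: funext => i; rewrite /join; case: split_ordP => j ->. Qed.

Section Join.
Variables (K : closedFieldType) (M N : nat).

Lemma polyfun_joinl (p : {mpoly K[M + N]}) x : polyfun (fun g => p.@[join g x]).
Proof.
apply: polyfun_comp => i; rewrite /join; case: split => a.
  exact: polyfun_coord.
exact: polyfun_cst.
Qed.

Lemma polyfun_joinr (p : {mpoly K[M + N]}) g : polyfun (fun x => p.@[join g x]).
Proof.
apply: polyfun_comp => i; rewrite /join; case: split => a.
  exact: polyfun_cst.
exact: polyfun_coord.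
Qed.

Lemma join_prime (S : set ('I_N -> K)) : prime_ideal (vanishing S) ->
  prime_ideal (vanishing [set v : 'I_(M + N) -> K | S (fun b => v (rshift M b))]).
Proof.
move=> pS; apply: vanishing_prime.
  have /nvanishingP[x [Sx _]] := pideal1 pS.
  by exists (join (fun=> 0) x); rewrite /= (_ : (fun b => _) = x) //;
     apply: funext => b; rewrite join_rshift.
move=> p q [v [Sv pv]] [w [Sw qw]].
have [f fE] := polyfun_joinl p (fun b => v (rshift M b)).
have [h hE] := polyfun_joinl q (fun b => w (rshift M b)).
have [g] : exists g, (f * h).@[g] != 0.
  apply: mpoly_nonroot; rewrite mulf_neq0 //.
    by apply: contraNneq pv => f0; rewrite -(join_shift v) fE f0 meval0.
  by apply: contraNneq qw => h0; rewrite -(join_shift w) hE h0 meval0.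
rewrite mevalM mulf_eq0 negb_or -fE -hE => /andP[pg qg].
have [f' f'E] := polyfun_joinr p g.
have [h' h'E] := polyfun_joinr q g.
have [||x [Sx fx hx]] := prime_common_nonroot (p := f') (q := h') pS.
- by eexists; split; [exact: Sv | rewrite -f'E].
- by eexists; split; [exact: Sw | rewrite -h'E].
exists (join g x); rewrite f'E h'E; split=> //=.
by rewrite (_ : (fun b => _) = x) //; apply: funext => b; rewrite join_rshift.
Qed.

End Join.

Section Lower.
Variables (K : closedFieldType) (n m : nat) (X : 'I_m.+1 -> set (proj K n)).
Hypothesis vX : forall j, variety (X j).

Let Xi := product_set (fun j => cone (X j)).

Let pXi : prime_ideal (vanishing Xi).
Proof. exact/product_set_prime/variety_cone. Qed.

Section SpecialMatrices.
Variables (D : 'I_m.+1 -> nat) (e : forall j, 'I_(D j).+1 -> 'I_n.+1).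
Arguments e : clear implicits.
Hypothesis inde : forall j, indep (vanishing (cone (X j))) (fun i => 'X_(e j i)).
Variable x0 : 'I_n.+1 -> K.
Hypothesis Xx0 : cone (X ord_max) x0.
Hypothesis x00 : forall i, x0 i != 0.

(** One slot for each independent coordinate of the first [m] factors except the [e j ord0], which
    serve for normalization. *)
Let slot := {j : 'I_m & 'I_(D (lift ord_max j))}.

Let slot_coord (u : slot) : 'I_m * 'I_n.+1 :=
  (tag u, e (lift ord_max (tag u)) (lift ord0 (tagged u))).

Let slot_coord_inj : injective slot_coord.
Proof.
move=> [j r] [j' r'] [/= ej]; rewrite -ej in r' *.
by move=> /(indep_inj (@inde _))/lift_inj ->.
Qed.

Let slot_coord_neq0 u j : slot_coord u <> (j, e (lift ord_max j) ord0).
Proof. by case: u => j' r [/= ej]; rewrite -ej => /(indep_inj (@inde _))/eqP. Qed.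

Let card_slot : #|{: slot}| = (\sum_(j < m) D (lift ord_max j))%N.
Proof.
rewrite card_tagged sumnE big_map big_enum /=.
by apply: eq_bigr => j _; rewrite card_ord.
Qed.

(* Each matrix selects coordinates: the rows filled by a slot of the factor [j]
   are sent to the corresponding independent coordinate of [X j], the others to
   its coordinate [e j ord0], which can be specialized to 1. *)
Lemma dense_special : exists (A : 'I_m -> 'M[K]_n.+1) (E : {set 'I_n.+1}),
  ((minn n (\sum_j D j)).+1 <= #|E|)%N /\
  dense_image Xi (fun x (i : 'I_#|E|) => hprod A (unflat x) (enum_val i)).
Proof.
(* The rows in [B] are controlled by the last factor, those in [F] by the slots. *)
pose B := [set e ord_max r | r : 'I_(D ord_max).+1]%SET.
have cardB : #|B| = (D ord_max).+1.
  by rewrite card_imset ?card_ord //; exact: indep_inj (@inde _).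
have [f [fB cardF f_inj]] := partial_matching slot (~: B).
pose F := [set i | f i]%SET.
pose E := B :|: F.
pose sel j i := if omap slot_coord (f i) is Some (l, c)
  then if l == j then c else e (lift ord_max j) ord0
  else e (lift ord_max j) ord0.
pose A j : 'M[K]_n.+1 := \matrix_(i, b) (b == sel j i)%:R.
have AE xi i : hprod A xi i =
    xi ord_max i * \prod_(j < m) xi (lift ord_max j) (sel j i).
  rewrite /hprod big_ord_recr /= [LHS]mulrC {1}/move_factor unlift_none.
  congr (_ * _); apply: eq_bigr => j _; rewrite lift_max_widen /move_factor liftK.
  rewrite (bigD1 (sel j i)) //= mxE eqxx mul1r big1 ?addr0 // => b /negbTE bs.
  by rewrite mxE bs mul0r.
exists A, E; split.
  have -> : #|E| = ((D ord_max).+1 + #|F|)%N.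
    rewrite cardsU cardB (_ : B :&: F = finset.set0) ?cards0 ?subn0 //.
    apply/finset.setP => i; rewrite !inE; apply/negP => /andP[iB /fB].
    by rewrite inE iB.
  rewrite addSn ltnS; apply: leq_trans (leq_add (leqnn _) cardF).
  rewrite card_slot cardsCs finset.setCK card_ord cardB subSS -leq_subLR.
  rewrite big_ord_recr /=; under [X in minn _ (X + _)]eq_bigr do rewrite lift_max_widen.
  by rewrite leq_min leq_sub2r ?geq_minl //= leq_subLR addnC geq_minr.
move=> p p0.
pose P : {mpoly K[n.+1]} := psub (fun i => 'X_(enum_val i)) p.
have PE v : P.@[v] = p.@[fun i => v (enum_val i)].
  by rewrite meval_psub; apply: meval_eq => i; rewrite mevalXU.
have depP v v' : (forall i, i \in E -> v i = v' i) -> P.@[v] = P.@[v'].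
  by move=> vv; rewrite !PE; apply: meval_eq => i; rewrite vv ?enum_valP.
have [b Pb] : exists b, P.@[b] != 0.
  have [eta peta] := mpoly_nonroot p0.
  exists (fun i => if [pick t | enum_val t == i] is Some t then eta t else 0).
  move: peta; rewrite PE; congr (_ != _); apply: meval_eq => t.
  by case: pickP => [t' /eqP/enum_val_inj ->|/(_ t)] //; rewrite eqxx.
have [R RE] : polyfun (fun v : 'I_n.+1 -> K =>
    P.@[fun i => if i \in B then v i else b i]).
  apply: polyfun_comp => i; case: (i \in B); first exact: polyfun_coord.
  exact: polyfun_cst.
have [v [Xv Rv]] : exists v, cone (X ord_max) v /\ R.@[v] != 0.
  apply: (indep_nonroot (@inde _) (w := b)).
    move=> w w' ww; rewrite -!RE; apply: meval_eq => i.
    by case: ifP => // /imsetP[r _ ->].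
  rewrite -RE; move: Pb; congr (_ != _); apply: meval_eq => i.
  by case: ifP.
(* The last factor is chosen first. It must have no zero coordinate, in order to divide by [x i]
   below; [x0] shows that this is possible. *)
have [x [Xx Rx]] : exists x, [/\ cone (X ord_max) x, R.@[x] != 0 &
    (\prod_(i < n.+1) 'X_i : {mpoly K[n.+1]}).@[x] != 0].
  apply: prime_common_nonroot; [exact: variety_cone| by exists v |].
  exists x0; split=> //; rewrite rmorph_prod /=; apply/prodf_neq0 => i _.
  by rewrite mevalXU.
rewrite rmorph_prod /= => /prodf_neq0 xn0.
have {}xn0 i : x i != 0 by have := xn0 i isT; rewrite mevalXU.
pose Q (omega : 'I_m -> 'I_n.+1 -> K) :=
  P.@[fun i => x i * \prod_(j < m) omega j (sel j i)] != 0.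
(* These vectors, not yet in the cones, give the product the value [b i] on the rows in [F] and
   [x i] on those in [B]. *)
pose omega0 (j : 'I_m) c := if [pick i | omap slot_coord (f i) == Some (j, c)] is Some i
  then b i / x i else 1.
have omega1 j : omega0 j (e (lift ord_max j) ord0) = 1.
  rewrite /omega0; case: pickP => // i; case: (f i) => //= u.
  by move=> /eqP/Some_inj/slot_coord_neq0.
have Q0 : Q omega0.
  move: Rx; rewrite /Q -RE; congr (_ != _); apply: depP => i.
  rewrite finset.in_setU; case: ifP => [iB _|_ /=].
    have fi : f i = None.
      by have := fB i; rewrite inE iB; case: (f i) => // u /(_ isT).
    by rewrite big1 ?mulr1 // => j _; rewrite /sel fi /= omega1.
  rewrite inE; case fi: (f i) => [u|] // _.
  rewrite (bigD1 (slot_coord u).1) //= big1 ?mulr1 => [|j ju].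
    rewrite /sel fi /= eqxx /omega0; case: pickP => [i' /eqP ei'|/(_ i)].
      have <- : i = i'.
        apply: f_inj; first by rewrite fi.
        move: ei'; case: (f i') => //= u' /Some_inj eu.
        by rewrite fi; congr Some; exact: slot_coord_inj.
      by rewrite mulrC divfK.
    by rewrite fi /= eqxx.
  by rewrite /sel fi /= eq_sym (negbTE ju) omega1.
(* As a function of the factor [j] alone, the product involves only the independent coordinates of
   [X j], so this factor can be moved into its cone. *)
have step omega j : Q omega ->
    exists w, cone (X (lift ord_max j)) w /\ Q (upd omega j w).
  move=> Qom.
  have [q qE] : polyfun (fun w : 'I_n.+1 -> K =>
      P.@[fun i => x i * \prod_(l < m) upd omega j w l (sel l i)]).
    apply: polyfun_comp => i; apply: polyfunM; first exact: polyfun_cst.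
    apply: polyfun_prod => l; rewrite /upd; case: eqP => _.
      exact: polyfun_coord.
    exact: polyfun_cst.
  suff [w [Xw qw]] : exists w, cone (X (lift ord_max j)) w /\ q.@[w] != 0.
    by exists w; split=> //; rewrite /Q qE.
  apply: (indep_nonroot (@inde (lift ord_max j)) (w := omega j)).
    move=> w w' ww; rewrite -!qE; apply: meval_eq => i; congr (_ * _).
    apply: eq_bigr => l _; rewrite /upd; case: eqP => // ->.
    have [r ->] : exists r, sel j i = e (lift ord_max j) r.
      rewrite /sel; case: (f i) => [[l' r]|] /=; last by exists ord0.
      case: eqP => [el|_]; last by exists ord0.
      by rewrite -el; exists (lift ord0 r).
    exact: ww.
  rewrite -qE; move: Qom; rewrite /Q; congr (_ != _); apply: meval_eq => i.
  congr (_ * _); apply: eq_bigr => l _; rewrite /upd; case: eqP => // ->.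
  by [].
have [omega [Xom Qom]] := replace_factors step Q0.
exists (flat (snoc omega x)); split.
  move=> j; rewrite flatK; move: j; apply: snoc_ind => [j|].
    by rewrite snoc_lift; exact: Xom.
  by rewrite snoc_max.
move: Qom; rewrite /Q PE flatK; congr (_ != _); apply: meval_eq => t.
rewrite AE snoc_max; congr (_ * _); apply: eq_bigr => j _.
by rewrite snoc_lift.
Qed.

End SpecialMatrices.

(** [J] is the ideal of the affine image of the product map, prime as a preimage. The closure of the
    Hadamard image is that of the zeros of [J], so [chain_of_indep] applies. *)
Lemma chain_of_dense A s (h : 'I_s.+1 -> 'I_n.+1) :
  dense_image Xi (fun x i => hprod A (unflat x) (h i)) ->
  irr_chain (zclosure (himage A X)) s.
Proof.
move=> dh.
have [f fE] := polyfun_psub (fun i => polyfun_hprod A i).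
pose J := [set p | vanishing Xi (psub f p)].
have pJ : prime_ideal J by exact: prime_ideal_preim.
have indJ : indep J (fun i => 'X_(h i)).
  move=> p Jp; apply/eqP/negPn/negP => /dh[x [Xx]].
  have := Jp x Xx; rewrite fE meval_psub => <-.
  by apply/negP/negPn/eqP/meval_eq => i; rewrite mevalXU.
have nJh : ~ J 'X_(h ord0).
  move=> Jh; have := indJ 'X_ord0; rewrite psubX => /(_ Jh)/eqP.
  by rewrite (negbTE (mpolyXU_neq0 _ _)).
have -> : zclosure (himage A X) = zclosure (projective_zeros J).
  apply/seteqP; split; apply: zclosure_min; try exact: zclosure_closed.
    move=> _ [xi [w [cxi -> ew]]]; apply: subset_zclosure; exists w; split=> // p Jp.
    have Xxi : Xi (flat xi) by move=> j; rewrite flatK.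
    by have := Jp _ Xxi; rewrite fE flatK ew.
  move=> _ [w [-> Jw]] Z [[S Sh ->] SZ] p Sp; have [d hd] := Sh _ Sp.
  apply/(hvanish_coord _ hd); apply: Jw.
  (* The equation [p] is only known to vanish at the nonzero products; the extra factor takes care
     of the zero ones. *)
  suff /(pideal_prime pJ)[] : J (p * 'X_(h ord0)) by [].
  move=> x Xx; rewrite fE mevalM mevalXU; apply/eqP.
  have [->|z0] := eqVneq (hprod A (unflat x) (h ord0)) 0; first by rewrite mulr0.
  have [|w' ew'] := @nzvec_of _ _ (hprod A (unflat x)); first by exists (h ord0).
  rewrite mulf_eq0 (negbTE z0) orbF ew'; apply/eqP/(hvanish_coord _ hd).
  by apply: (SZ _ _ _ Sp); exists (unflat x), w'.
apply: (chain_of_indep (e := h)); first exact: prime_zeros_variety pJ nJh.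
exact: indep_mono (vanishing_prime_zeros pJ nJh) indJ.
Qed.

Let M := #|{: 'I_m * 'I_n.+1 * 'I_n.+1}|.
Let N := #|{: 'I_m.+1 * 'I_n.+1}|.

Definition matrices_of (g : 'I_M -> K) (j : 'I_m) : 'M[K]_n.+1 :=
  \matrix_(a, b) g (enum_rank (j, a, b)).

Lemma polyfun_matrices i : polyfun (fun v : 'I_(M + N) -> K =>
  hprod (matrices_of (fun a => v (lshift N a))) (unflat (fun b => v (rshift M b))) i).
Proof.
apply: polyfun_prod => j; rewrite /move_factor; case: unlift => [l|].
  apply: polyfun_sum => b; apply: polyfunM.
    by exists 'X_(lshift N (enum_rank (l, i, b))) => v; rewrite mxE mevalXU.
  exact: polyfun_coord.
exact: polyfun_coord.
Qed.

(** The matrices become variables: the map sending [(g, x)] to [g] and its product coordinates is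
    dominant, hence hits almost all pairs, and a general fibre over [g] inherits density. *)
Lemma dense_family s (h : 'I_s -> 'I_n.+1) (A : 'I_m -> 'M[K]_n.+1) :
  dense_image Xi (fun x i => hprod A (unflat x) (h i)) ->
  exists P : {mpoly K[M]}, P != 0 /\ forall g, P.@[g] != 0 ->
    dense_image Xi (fun x i => hprod (matrices_of g) (unflat x) (h i)).
Proof.
move=> dA.
pose GXi : set ('I_(M + N) -> K) := [set v | Xi (fun b => v (rshift M b))].
have pGXi : prime_ideal (vanishing GXi) by exact: join_prime.
pose g0 : 'I_M -> K := fun t => let: (j, a, b) := enum_val t in A j a b.
have g0E : matrices_of g0 = A.
  apply: funext => j; apply/matrixP => a b.
  by rewrite mxE /g0 enum_rankK.
pose H i (v : 'I_(M + N) -> K) : K := match split i with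
  | inl a => v (lshift N a)
  | inr t => hprod (matrices_of (fun a => v (lshift N a)))
               (unflat (fun b => v (rshift M b))) (h t) end.
have HE g x : H^~ (join g x) =
    join g (fun t : 'I_s => hprod (matrices_of g) (unflat x) (h t)).
  have eg : (fun a => join g x (lshift N a)) = g.
    by apply: funext => a; rewrite join_lshift.
  have ex : (fun b => join g x (rshift M b)) = x.
    by apply: funext => b; rewrite join_rshift.
  apply: funext => i; rewrite /H eg ex [RHS]/join; case: split => // a.
  exact: join_lshift.
have dH : dense_image GXi (fun v => H^~ v).
  move=> p p0; apply: contrapT => np.
  have pz g x : Xi x ->
      p.@[join g (fun t : 'I_s => hprod (matrices_of g) (unflat x) (h t))] = 0.
    move=> Xx; apply/eqP/negPn/negP => pgx; apply: np; exists (join g x).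
    rewrite HE; split=> //; rewrite /GXi /= (_ : (fun b => _) = x) //.
    by apply: funext => b; rewrite join_rshift.
  have [v pv] := mpoly_nonroot p0.
  (* The line joins the special matrices at [u = 0] to the matrix part of [v] at [u = 1]; [Q] is the
     restriction of [p] to it. *)
  pose line (u : K) a := g0 a + u * (v (lshift s a) - g0 a).
  pose Q : {poly {mpoly K[s]}} := mmap (polyC \o @mpolyC s K)
    (fun i => match split i with
      | inl a => (g0 a)%:MP%:P + 'X * ((v (lshift s a) - g0 a)%:MP)%:P
      | inr t => ('X_t)%:P end) p.
  have QE u y : Q.[u%:MP].@[y] = p.@[join (line u) y].
    apply: (@mpoly_rmorph_eq _ _ _ (meval y \o horner_eval (u%:MP : {mpoly K[s]})
      \o mmap (polyC \o @mpolyC s K) _) (meval (join (line u) y))) => [d|i] /=.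
      by rewrite mmapC /= /horner_eval hornerC !mevalC.
    rewrite mmapX mmap1U mevalXU /horner_eval /join; case: split => a.
      by rewrite hornerD hornerM hornerX !hornerC mevalD mevalM !mevalC.
    by rewrite hornerC mevalXU.
  have Q0 : Q = 0.
    apply: (@line_specialization _ _ _ Xi
      (fun u x t => hprod (matrices_of (line u)) (unflat x) (h t))).
    - move=> x i; have [q qE] := polyfun_matrices (h i).
      exists (mmap polyC (join (fun a => (g0 a)%:P + 'X * (v (lshift s a) - g0 a)%:P)
        (fun b => (x b)%:P)) q) => u.
      have := qE (join (line u) x).
      have -> : (fun a => join (line u) x (lshift N a)) = line u.
        by apply: funext => a; rewrite join_lshift.
      have -> : (fun b => join (line u) x (rshift M b)) = x.
        by apply: funext => b; rewrite join_rshift.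
      move=> ->.
      apply: esym; apply: (@mpoly_rmorph_eq _ _ _ (horner_eval u
        \o mmap polyC _) (meval (join (line u) x))) => [d|l] /=.
        by rewrite mmapC mevalC /horner_eval hornerC.
      rewrite mmapX mmap1U mevalXU /horner_eval /join; case: split => a.
        by rewrite hornerD hornerM hornerX !hornerC.
      by rewrite hornerC.
    - rewrite (_ : line 0 = g0) ?g0E //.
      by apply: funext => a; rewrite /line mul0r addr0.
    - by move=> u x Xx; rewrite QE pz.
  move/eqP: pv; apply; rewrite -(join_shift v).
  have -> : (fun a => v (lshift s a)) = line 1.
    by apply: funext => a; rewrite /line mul1r addrC subrK.
  by rewrite -QE Q0 horner0 meval0.
have /boolp.choice[f fE] i : polyfun (H i).
  rewrite /H; case: split => a; first exact: polyfun_coord.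
  exact: polyfun_matrices.
have [|Dl [Dl0 lift]] := @lift_points _ _ _ _ f pGXi.
  apply/dense_image_indep => p /dH[v [Gv pv]]; exists v; split=> //.
  by move: pv; congr (_ != _); apply: meval_eq => i; rewrite fE.
have [v0] := mpoly_nonroot Dl0; rewrite -(join_shift v0) => Dv0.
set eta0 := fun b => v0 (rshift M b) in Dv0.
have [P PE] := polyfun_joinl Dl eta0.
exists P; split.
  by apply: contraNneq Dv0 => P0; rewrite PE P0 meval0.
move=> g; rewrite -PE => Dg p p0; apply: contrapT => np.
(* [q] is nonzero, having the nonroot [eta0]; hence some [y] is a nonroot of [p] for which [(g, y)]
   lifts. *)
have [q qE] := polyfun_joinr Dl g.
have [y] : exists y, (p * q).@[y] != 0.
  apply: mpoly_nonroot; rewrite mulf_neq0 //.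
  by apply: contraNneq Dg => q0; rewrite qE q0 meval0.
rewrite mevalM mulf_eq0 negb_or -qE => /andP[/eqP py Dgy]; apply: py.
have [v [Iv fv]] := lift _ Dgy.
have vg : (fun a => v (lshift N a)) = g.
  apply: funext => a; have := fv (lshift s a).
  rewrite -fE join_lshift /H; case: split_ordP => b /eqP; rewrite ?eq_lshift ?eq_lrshift //.
  by move=> /eqP ->.
(* The lifted [v] is only a zero of the ideal of [GXi], so the vanishing of [p] is carried to it by
   a polynomial with [g] frozen. *)
have [F FE] : polyfun (fun w : 'I_(M + N) -> K =>
    p.@[fun t => hprod (matrices_of g) (unflat (fun b => w (rshift M b))) (h t)]).
  apply: polyfun_comp => t; apply: polyfun_prod => j; rewrite /move_factor.
  case: unlift => [l|]; last exact: polyfun_coord.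
  apply: polyfun_sum => b; apply: polyfunM; first exact: polyfun_cst.
  exact: polyfun_coord.
have /Iv : vanishing GXi F.
  move=> w Gw; rewrite -FE; apply/eqP/negPn/negP => pw.
  by apply: np; exists (fun b => w (rshift M b)).
rewrite -FE => <-; apply: meval_eq => t.
have := fv (rshift M t); rewrite -fE join_rshift /H.
case: split_ordP => b /eqP; rewrite ?eq_rshift ?eq_rlshift //.
by move=> /eqP ->; rewrite vg.
Qed.

End Lower.

(** * General elements of PGL *)

Lemma chain_le (K : closedFieldType) n (Y : set (proj K n)) d :
  irr_chain Y d -> (d <= n)%N.
Proof.
move=> /indep_of_chain[e /indep_inj e_inj].
by rewrite -ltnS -(card_ord d.+1) -(card_ord n.+1); exact: leq_card e_inj.
Qed.

Lemma variety_dim (K : closedFieldType) n (Y : set (proj K n)) : variety Y ->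
  exists D, irr_chain Y D /\ forall d, irr_chain Y d -> (d <= D)%N.
Proof.
move=> vY; pose Q d := `[< irr_chain Y d >].
have exQ : exists d, Q d.
  by exists 0%N; apply/asboolP; exists (fun=> Y); split=> // i _; split.
have Qn d : Q d -> (d <= n)%N by move=> /asboolP /chain_le.
case: (ex_maxnP exQ Qn) => D /asboolP YD Dmax; exists D; split=> // d Yd.
by apply: Dmax; apply/asboolP.
Qed.

Lemma zdimE (R : realType) n (Y : set (proj R[i] n)) D :
  irr_chain Y D -> (forall d, irr_chain Y d -> (d <= D)%N) ->
  zdim Y = D%:R%:E.
Proof.
move=> YD Dmax; apply/eqP; rewrite eq_le; apply/andP; split.
  by apply: ge_ereal_sup => _ [d /= Yd <-]; rewrite lee_fin ler_nat; exact: Dmax.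
by apply: ereal_sup_ubound; exists D.
Qed.

Section ProjectiveLinearGroup.
Variables (K : closedFieldType) (n m : nat).

Let M := #|{: 'I_m * 'I_n.+1 * 'I_n.+1}|.

Lemma matrices_of_gl_entry (A : 'I_m -> glmx K n) :
  matrices_of (gl_entry A) = fun j => val (A j).
Proof.
apply: funext => j; apply/matrixP => a b.
by rewrite mxE /gl_entry enum_rankK.
Qed.

Lemma polyfun_entry (j : 'I_m) a b :
  polyfun (fun g : 'I_M -> K => matrices_of g j a b).
Proof. by exists 'X_(enum_rank (j, a, b)) => v; rewrite mxE mevalXU. Qed.

Lemma gl_entryE (A : 'I_m -> glmx K n) t :
  gl_entry A t = val (A (enum_val t).1.1) (enum_val t).1.2 (enum_val t).2.
Proof. by rewrite /gl_entry; case: enum_val => -[]. Qed.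

(** [P] need not be invariant under scalars. The open set consists of the classes with some
    representative off the zeros of [P], and its equations are the rescalings of [P]. *)
Lemma pgl_general_nonroot (P : {mpoly K[M]}) (Q : ('I_m -> pgl K n) -> Prop) :
  P != 0 ->
  (forall A : 'I_m -> glmx K n, P.@[gl_entry A] != 0 ->
     Q (fun j => pgl_of (A j))) ->
  pgl_general Q.
Proof.
move=> P0 PQ.
exists [set g | exists A : 'I_m -> glmx K n,
  (forall j, g j = pgl_of (A j)) /\ P.@[gl_entry A] != 0]; split.
- pose scaled (lam : 'I_m -> K) : {mpoly K[M]} :=
    psub (fun t => lam (enum_val t).1.1 *: 'X_t) P.
  have scaledE lam (A A' : 'I_m -> glmx K n) :
      (forall j, val (A' j) = lam j *: val (A j)) ->
      (scaled lam).@[gl_entry A] = P.@[gl_entry A'].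
    move=> AA'; rewrite meval_psub; apply: meval_eq => t.
    by rewrite mevalZ mevalXU !gl_entryE AA' mxE.
  exists [set q | exists lam, (forall j, lam j != 0) /\ q = scaled lam].
  move=> A /=; split=> [[A' [AA' PA']]|[_ [lam [lam0 ->]] PA]].
    have /boolp.choice[lam lamP] j : exists c, c != 0 /\ val (A' j) = c *: val (A j).
      by have /esym/pgl_of_eq[c c0 e] := AA' j; exists c.
    exists (scaled lam); first by exists lam; split=> // j; have [] := lamP j.
    by rewrite (scaledE lam A A') // => j; have [] := lamP j.
  have uA j : lam j *: val (A j) \in unitmx.
    by rewrite unitmxZ ?unitfE //; exact: valP.
  pose A' j : glmx K n := Sub (lam j *: val (A j)) (uA j).
  exists A'; rewrite -(scaledE lam A A') //; split=> // j.
  by apply/esym/pgl_of_eq; exists (lam j).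
(* A common nonroot of [P] and of the determinants gives invertible matrices, so the open set is not
   empty. *)
- have [d dE] : polyfun (fun g : 'I_M -> K => \prod_(j < m) \det (matrices_of g j)).
    apply: polyfun_prod => j; apply: polyfun_sum => s; apply: polyfunM.
      exact: polyfun_cst.
    by apply: polyfun_prod => i; exact: polyfun_entry.
  have d0 : d != 0.
    pose g1 : 'I_M -> K := fun t => ((enum_val t).1.2 == (enum_val t).2)%:R.
    apply/eqP => d0; have := dE g1; rewrite d0 meval0 => /eqP.
    apply/negP; apply/prodf_neq0 => j _; rewrite (_ : matrices_of g1 j = 1%:M).
      by rewrite det1 oner_eq0.
    by apply/matrixP => a b; rewrite !mxE /g1 enum_rankK.
  have [g] := mpoly_nonroot (mulf_neq0 P0 d0).
  rewrite mevalM -dE mulf_eq0 negb_or => /andP[Pg /prodf_neq0 dg].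
  have ug j : matrices_of g j \in unitmx by rewrite unitmxE unitfE dg.
  pose A j : glmx K n := Sub (matrices_of g j) (ug j).
  exists (fun j => pgl_of (A j)), A; split=> //; move: Pg; congr (_ != _).
  apply: meval_eq => t; rewrite gl_entryE /A /= mxE.
  by rewrite -!surjective_pairing enum_valK.
- move=> g [A [/funext -> PA]]; exact: PQ.
Qed.

End ProjectiveLinearGroup.

(* k = m.+1, and X_k = X ord_max. *)
Theorem theorem1p1 (R : realType) (n m : nat)
    (X : 'I_m.+1 -> set (proj R[i] n)) :
  (2 <= m.+1)%N ->
  (forall i, variety (X i)) ->
  ~ (X ord_max `<=` @coord_hyperplanes R[i] n) ->
  pgl_general (fun g : 'I_m -> pgl R[i] n =>
    zdim (hadamard (translate g X)) =
    Order.min n%:R%:E (\sum_(i < m.+1) zdim (X i))%E).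
Proof.
move=> _ vX /existsNP[P /not_implyP[XP nP]].
have /boolp.choice[D DP] j := variety_dim (vX j).
pose e j := sval (cid (indep_of_chain (DP j).1)).
have inde j : indep (vanishing (cone (X j))) (fun i => 'X_(e j i)).
  exact: svalP (cid (indep_of_chain (DP j).1)).
have XP' : cone (X ord_max) (fun i => coords P i 0).
  exists (Sub (coords P) (coords_neq0 P)); rewrite proj_of_coords; split=> //.
have P0 i : coords P i 0 != 0 by apply/eqP => Pi; apply: nP; exists i.
have [A0 [E [cardE dA0]]] := dense_special vX inde XP' P0.
have [p [p0 dp]] := dense_family vX dA0.
apply: (pgl_general_nonroot p0) => A /dp; rewrite matrices_of_gl_entry => dA.
rewrite hadamard_translate.
have zX i : zdim (X i) = (D i)%:R%:E by apply: zdimE; have [] := DP i.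
under eq_bigr do rewrite zX.
set s := minn n (\sum_j D j).
have [t [st Yt]] : exists t, (s <= t)%N /\
    irr_chain (zclosure (himage (fun j => val (A j)) X)) t.
  (* A dense set of [q] coordinates gives a chain of length [q.-1], and [E] has at least [s.+1]
     elements. *)
  have bound q (h : 'I_q -> 'I_n.+1) :
      dense_image (product_set (fun j => cone (X j)))
        (fun x i => hprod (fun j => val (A j)) (unflat x) (h i)) -> (s < q)%N ->
      exists t, (s <= t)%N /\
        irr_chain (zclosure (himage (fun j => val (A j)) X)) t.
    by case: q h => // q h /(chain_of_dense vX) Yq sq; exists q.
  exact: bound dA cardE.
have le_s d : irr_chain (zclosure (himage (fun j => val (A j)) X)) d -> (d <= s)%N.
  move=> Yd; rewrite leq_min (chain_le Yd) /=.
  by apply: hadamard_dim_le Yd => // j d' /(DP j).2.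
have et : t = s by apply/eqP; rewrite eqn_leq st le_s.
rewrite (zdimE (D := s)) -?et //; last by rewrite et.
rewrite et sumEFin -natr_sum -EFin_min /s.
by rewrite natr_min.
Qed.
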